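(* Let $\lambda\in\Lambda[a,b]$, and let $U=\{U(t,s): a\le s\le t\le b\}$ be a regulated evolution in $\mathbb R$ such that the function $U_a:=U(\cdot,a)$ belongs to $L_\lambda[a,b]$. Then (a), (b) and (c) hold, where: (a) the function $\mathcal L_\lambda U_a$ is defined on $[a,b]$, it belongs to $E_\lambda[a,b]$, and it is the $\lambda$-generator of $U$; (b) the product $\lambda$-integral with respect to $\mathcal L_\lambda U_a$ is defined on $[a,b]$; (c) the function $\mathcal L_\lambda U_a$ is the unique, up to an additive constant, function $g\in E_\lambda[a,b]$ such that the product $\lambda$-integral with respect to $g$ is defined on $[a,b]$ and $$U(t,s)=\prod_s^t(1+d_\lambda g)\qquad\text{for all } a\le s\le t\le b .$$ In particular, $U(t,s)=\prod_s^t\big(1+d_\lambda(\mathcal L_\lambda U_a)\big)$ for all $a\le s\le t\le b$.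
   Context: Fix real $a<b$. A function $f:[a,b]\to\mathbb R$ is regulated if the finite limits $f(t-)$, $t\in(a,b]$, and $f(s+)$, $s\in[a,b)$, exist. Put $\Delta^-f(t)=f(t)-f(t-)$ on $(a,b]$, $\Delta^+f(s)=f(s+)-f(s)$ on $[a,b)$, and $\Delta^-f(a)=\Delta^+f(b)=0$. Write $f\gg0$ if there is a constant $C>0$ with $f(t)\ge C$ for all $t\in[a,b]$. $\Lambda[a,b]$ is the set of sequences $\lambda=\{\lambda_m:m\ge1\}$ of partitions (finite sets $a=t_0<\dots<t_n=b$) of $[a,b]$ with $\lambda_m\subset\lambda_{m+1}$ and $\cup\lambda:=\bigcup_m\lambda_m$ dense in $[a,b]$. For $a\le s<t\le b$ let $\lambda_m|_{[s,t]}=\{s,t\}\cup(\lambda_m\cap(s,t))=\{s=x_0<\dots<x_n=t\}$ (the points $x_i$ and $n$ depend on $m$). Quadratic $\lambda$-variation: a regulated $f$ has the quadratic $\lambda$-variation on $[a,b]$, written $f\in Q_\lambda[a,b]$, if there is a regulated $V$ on $[a,b]$ with $V(a)=0$ and, for all $a\le s<t\le b$, $V(t)-V(s)=\lim_{m\to\infty}\sum_i[f(x_i)-f(x_{i-1})]^2$ (sum over $\lambda_m|_{[s,t]}$), $\Delta^-V(t)=(\Delta^-f(t))^2$ and $\Delta^+V(s)=(\Delta^+f(s))^2$. Classes: $L_\lambda[a,b]=\{f\in Q_\lambda[a,b]: f(a)=1,\ f\gg0,\ \{t\in(a,b):\Delta^+f(t)\ne0\}\subset\cup\lambda\}$; $E_\lambda[a,b]=\{g\in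 Q_\lambda[a,b]: g(a)=0,\ 1+\min(\Delta^-g,\Delta^+g)\gg0,\ \{t\in(a,b):\Delta^+g(t)\ne0\}\subset\cup\lambda\}$. Left Cauchy $\lambda$-integral: for regulated $g,f$, $(LC)\int g\,d_\lambda f$ is defined on $[a,b]$ if there is a regulated $\Phi$ with $\Phi(a)=0$ and, for all $a\le s<t\le b$, $\Phi(t)-\Phi(s)=\lim_{m\to\infty}\sum_i g(x_{i-1})[f(x_i)-f(x_{i-1})]$ (sum over $\lambda_m|_{[s,t]}$), $\Delta^-\Phi(t)=g(t-)\Delta^-f(t)$, $\Delta^+\Phi(s)=g(s)\Delta^+f(s)$; then $(LC)\int_s^t g\,d_\lambda f:=\Phi(t)-\Phi(s)$. The function $\mathcal L_\lambda f$ is defined on $[a,b]$ if $(LC)\int f^{-1}\,d_\lambda f$ is defined on $[a,b]$, and then $\mathcal L_\lambda f(t)=(LC)\int_a^t f^{-1}\,d_\lambda f$. Product $\lambda$-integral: for regulated $f$, it is defined on $[a,b]$ if there is a regulated $H$ with $H(a)=1$, $|H|\gg0$ and, for all $a\le s<t\le b$, $H(t)/H(s)=\lim_{m\to\infty}\prod_i[1+f(x_i)-f(x_{i-1})]$ (product over $\lambda_m|_{[s,t]}$), $H(t)/H(t-)=1+\Delta^-f(t)$, $H(s+)/H(s)=1+\Delta^+f(s)$; then $\prod_s^t(1+d_\lambda f):=H(t)/H(s)$ for $a\le s\le t\le b$. An evolution in $\mathbb R$ on $[a,b]$ is a family $\{U(t,s):a\le s\le t\le b\}$ of real numbers with $U(r,t)U(t,s)=U(r,s)$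 for $s\le t\le r$ and $U(t,t)=1$. It is regulated if and only if $U_a$ is a regulated function and $|U_a|\gg0$. A regulated evolution $U$ has $\lambda$-generator $G$ if $G$ is a regulated function on $[a,b]$ with $G(a)=0$ and, for all $a\le s<t\le b$, $G(t)-G(s)=\lim_{m\to\infty}\sum_i[U(x_i,x_{i-1})-1]$ (sum over $\lambda_m|_{[s,t]}$), $\Delta^-G(t)=U_a(t)/U_a(t-)-1$, $\Delta^+G(s)=U_a(s+)/U_a(s)-1$. *)

(* Defs.v *)
(* A function on [a, b] is encoded as a total function R -> R; values outside
   [a, b] are never used: the left limit at t is only taken for a < t and the
   right limit at s only for s < b. *)
From HB Require Import structures.
From mathcomp Require Import all_boot all_order all_algebra.
From mathcomp Require Import all_classical all_reals all_analysis.

Set Implicit Arguments.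
Unset Strict Implicit.
Unset Printing Implicit Defensive.

Import Order.TTheory GRing.Theory Num.Theory.
Import numFieldNormedType.Exports.
Local Open Scope classical_set_scope.
Local Open Scope ring_scope.

Section LambdaCalculus.
Variable R : realType.
Implicit Types (a b s t : R) (f g : R -> R) (lam : nat -> seq R)
  (U : R -> R -> R).

Definition regulated a b f : Prop :=
  (forall t, a < t <= b -> cvg (f x @[x --> t^'-])) /\
  (forall s, a <= s < b -> cvg (f x @[x --> s^'+])).

Definition llim f t : R := lim (f x @[x --> t^'-]).
Definition rlim f s : R := lim (f x @[x --> s^'+]).

Definition ljump a f t : R := if a < t then f t - llim f t else 0.
Definition rjump b f s : R := if s < b then rlim f s - f s else 0.

(* f >> 0 *)
Definition bounded_below_pos a b f : Prop :=
  exists2 C : R, 0 < C & forall t, a <= t <= b -> C <= f t.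

(* [itv_partition a b l] leaves the left endpoint out of l: the partition is
   the set of elements of a :: l. *)
Definition union_partitions a lam : set R :=
  [set x | exists m, x \in a :: lam m].

(* The sequence is indexed from m = 0. *)
Definition nested_partitions a b lam : Prop :=
  [/\ forall m, itv_partition a b (lam m),
      forall m, {subset a :: lam m <= a :: lam m.+1} &
      [set x | a <= x <= b] `<=` closure (union_partitions a lam)].

(* The restriction to [s, t], left endpoint s included, for s < t. *)
Definition restr (l : seq R) s t : seq R :=
  s :: itv_partitionL (itv_partitionR l s) t.

Definition is_quadratic_variation a b lam f (V : R -> R) : Prop :=
  [/\ regulated a b V, V a = 0,
      forall s t, a <= s -> s < t -> t <= b ->
        (\sum_(1 <= i < size (restr (lam m) s t))
            (f (restr (lam m) s t)`_i - f (restr (lam m) s t)`_i.-1) ^+ 2)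
          @[m --> \oo] --> V t - V s,
      forall t, a < t <= b -> ljump a V t = ljump a f t ^+ 2 &
      forall s, a <= s < b -> rjump b V s = rjump b f s ^+ 2].

Definition Qclass a b lam f : Prop :=
  regulated a b f /\ exists V, is_quadratic_variation a b lam f V.

Definition Lclass a b lam f : Prop :=
  [/\ Qclass a b lam f, f a = 1, bounded_below_pos a b f &
      [set t | a < t < b /\ rjump b f t != 0] `<=` union_partitions a lam].

Definition Eclass a b lam g : Prop :=
  [/\ Qclass a b lam g, g a = 0,
      bounded_below_pos a b
        (fun t => 1 + Num.min (ljump a g t) (rjump b g t)) &
      [set t | a < t < b /\ rjump b g t != 0] `<=` union_partitions a lam].

Definition is_LC_integral a b lam g f (Phi : R -> R) : Prop :=
  [/\ regulated a b Phi, Phi a = 0,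
      forall s t, a <= s -> s < t -> t <= b ->
        (\sum_(1 <= i < size (restr (lam m) s t))
            g (restr (lam m) s t)`_i.-1 *
            (f (restr (lam m) s t)`_i - f (restr (lam m) s t)`_i.-1))
          @[m --> \oo] --> Phi t - Phi s,
      forall t, a < t <= b -> ljump a Phi t = llim g t * ljump a f t &
      forall s, a <= s < b -> rjump b Phi s = g s * rjump b f s].

Definition LC_integrable a b lam g f : Prop :=
  [/\ regulated a b g, regulated a b f &
      exists Phi, is_LC_integral a b lam g f Phi].

(* Phi is unique on [a, b], so the choice made by [get] does not matter. *)
Definition LC_integral a b lam g f s t : R :=
  let Phi := get [set Phi : R -> R | is_LC_integral a b lam g f Phi] in
  Phi t - Phi s.

Definition Lop_defined a b lam f : Prop :=
  LC_integrable a b lam (fun x => (f x)^-1) f.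

Definition Lop a b lam f t : R :=
  LC_integral a b lam (fun x => (f x)^-1) f a t.

Definition is_product_integral a b lam f (H : R -> R) : Prop :=
  [/\ regulated a b H /\ bounded_below_pos a b (fun t => `|H t|), H a = 1,
      forall s t, a <= s -> s < t -> t <= b ->
        (\prod_(1 <= i < size (restr (lam m) s t))
            (1 + f (restr (lam m) s t)`_i - f (restr (lam m) s t)`_i.-1))
          @[m --> \oo] --> H t / H s,
      forall t, a < t <= b -> H t / llim H t = 1 + ljump a f t &
      forall s, a <= s < b -> rlim H s / H s = 1 + rjump b f s].

Definition product_integrable a b lam f : Prop :=
  regulated a b f /\ exists H, is_product_integral a b lam f H.

(* H is unique on [a, b], so the choice made by [get] does not matter. *)
Definition product_integral a b lam f s t : R :=
  let H := get [set H : R -> R | is_product_integral a b lam f H] in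
  H t / H s.

(* U t s is only meaningful for a <= s <= t <= b. *)
Definition evolution a b U : Prop :=
  (forall s t r, a <= s -> s <= t -> t <= r -> r <= b ->
     U r t * U t s = U r s) /\
  (forall t, a <= t <= b -> U t t = 1).

Definition regulated_evolution a b U : Prop :=
  [/\ evolution a b U, regulated a b (U ^~ a) &
      bounded_below_pos a b (fun t => `|U t a|)].

Definition is_generator a b lam U (G : R -> R) : Prop :=
  [/\ regulated a b G, G a = 0,
      forall s t, a <= s -> s < t -> t <= b ->
        (\sum_(1 <= i < size (restr (lam m) s t))
            (U (restr (lam m) s t)`_i (restr (lam m) s t)`_i.-1 - 1))
          @[m --> \oo] --> G t - G s,
      forall t, a < t <= b ->
        ljump a G t = U t a / llim (U ^~ a) t - 1 &
      forall s, a <= s < b ->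
        rjump b G s = rlim (U ^~ a) s / U s a - 1].

End LambdaCalculus.

(* Main.v *)
Require Import Defs.
From HB Require Import structures.
From mathcomp Require Import all_boot all_order all_algebra.
From mathcomp Require Import all_classical all_reals all_analysis.
From mathcomp Require Import ring lra.
Import Order.TTheory GRing.Theory Num.Theory.
Import numFieldNormedType.Exports.
Local Open Scope classical_set_scope.
Local Open Scope ring_scope.

(** The sums in the definitions of the quadratic variation, of the left Cauchy
integral and of the generator have the form [sum F(x_(i-1), x_i)] for an
interval function [F], and so do the logarithms of the products. [burkill F G]
says that [G] is the indefinite integral of [F] along the partitions and that
the jumps of [G] are the limits of [F] on intervals shrinking to a point from
one side.

The engine is a local-to-global principle. Suppose that two interval functions
[q] and [w >= 0] are integrable in this sense. If near each point, on each side,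
[F] is [k q] up to an arbitrarily small multiple of [w], where [k] depends on
the point only, then over a short interval the sums of [F], apart from the one
interval that ends at the point, oscillate by at most [e] times the increment
of the integral of [w]. These local bounds add up, because inserting one cut
point changes the sums by a quantity that tends to 0: this is where one needs
right jumps to sit at partition points. Hence the oscillation over the whole
interval is at most [e] times a constant, for every [e], and the sums converge
([burkill_exists]). If [k = 0] and the limits of [F] at points vanish, the same
argument shows that the sums of [F] tend to 0 ([burkill_negligible]).

Let [f] be the evolution started at [a] and [l = ln f].
- Locally [(dl)^2] is [(df)^2 / f^2], so [l] has a quadratic variation.
- The sums of [df / f = exp(dl) - 1] exceed the telescoping sums of [dl] by
  those of [exp(dl) - 1 - dl], which is [(dl)^2 / 2] locally. So the integral [G]
  of [1/f] against [f] exists ([ratio_burkill]), it is the generator because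
  [U y x = f y / f x], and [G - l] is nondecreasing.
- Locally [(dG)^2] differs from [(dl)^2] by a small multiple of [d(G - l)], so
  [G] has a quadratic variation.
- For any [g] with right jumps at partition points, with [g - l] nondecreasing
  and with jumps related to those of [l] by [1 + jump g = exp(jump l)], the sums
  of [dg - ln(1 + dg)] and of [exp(dl) - 1 - dl] have the same limit, because
  both terms are half the same square up to a small multiple of
  [(dl)^2 + d(g - l)] ([log_defect_vs_ratio]).
- With [g = G] this gives [sum ln(1 + dG)] tending to the increment of [l], so
  [f] is the product integral of [G].
- Conversely, if [f] is the product integral of [g], then [g - l] is the limit
  of sums of [dg - ln(1 + dg)], which are eventually nonnegative. Hence it is
  nondecreasing, and the comparison identifies the increments of [g - l] with
  those of [G - l]. *)

Set Implicit Arguments.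
Unset Strict Implicit.

(** * Sums over a partition restricted to an interval *)

Section Sums.
Variable R : realType.
Implicit Types (F G : R -> R -> R) (l p : seq R) (s t r x y : R).

Definition inner l s t : seq R := [seq x <- l | s < x < t].

Definition path_sum F x p : R := \sum_(z <- pairmap F x p) z.

Definition lam_sum F l s t : R := path_sum F s (rcons (inner l s t) t).

Lemma path_sum_nil F x : path_sum F x [::] = 0.
Proof. by rewrite /path_sum big_nil. Qed.

Lemma path_sum_cons F x y p : path_sum F x (y :: p) = F x y + path_sum F y p.
Proof. by rewrite /path_sum /= big_cons. Qed.

Lemma path_sum_cat F x p1 p2 :
  path_sum F x (p1 ++ p2) = path_sum F x p1 + path_sum F (last x p1) p2.
Proof. by rewrite /path_sum pairmap_cat big_cat. Qed.

Lemma path_sum_rcons F x y p :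
  path_sum F x (rcons p y) = path_sum F x p + F (last x p) y.
Proof. by rewrite -cats1 path_sum_cat path_sum_cons path_sum_nil addr0. Qed.

Lemma path_sumD F G x p :
  path_sum (fun u v => F u v + G u v) x p = path_sum F x p + path_sum G x p.
Proof.
elim: p x => [|y p IH] x; first by rewrite !path_sum_nil addr0.
by rewrite !path_sum_cons IH addrACA.
Qed.

Lemma path_sumZ c F x p :
  path_sum (fun u v => c * F u v) x p = c * path_sum F x p.
Proof.
elim: p x => [|y p IH] x; first by rewrite !path_sum_nil mulr0.
by rewrite !path_sum_cons IH mulrDr.
Qed.

Lemma path_sum_telescope (f : R -> R) x p :
  path_sum (fun u v => f v - f u) x p = f (last x p) - f x.
Proof.
elim: p x => [|y p IH] x; first by rewrite path_sum_nil subrr.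
by rewrite path_sum_cons IH /=; lra.
Qed.

Lemma path_le_last x p : path <%R x p -> x <= last x p.
Proof.
elim: p x => //= y p IH x /andP[xy /IH]; exact/le_trans/ltW.
Qed.

Lemma path_lt_bounds x p y : path <%R x p -> y \in p -> x < y <= last x p.
Proof.
elim: p x => // z p IH x /= /andP[xz pz]; rewrite inE => /orP[/eqP ->|yp].
  by rewrite xz path_le_last.
by have /andP[zy ->] := IH z pz yp; rewrite (lt_trans xz zy).
Qed.

(** [D] stands for the one-sided neighbourhood in which an estimate is known,
so that no other pairs of points have to be compared. *)
Lemma path_sum_le (D : set R) F G x p : path <%R x p ->
  D x -> (forall y, y \in p -> D y) ->
  (forall u v, D u -> D v -> u < v -> F u v <= G u v) ->
  path_sum F x p <= path_sum G x p.
Proof.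
elim: p x => [|y p IH] x; first by rewrite !path_sum_nil.
move=> /= /andP[xy py] Dx Dp FG; rewrite !path_sum_cons lerD //.
  by apply: FG => //; apply: Dp; rewrite mem_head.
apply: IH => //; first by apply: Dp; rewrite mem_head.
by move=> z zp; apply: Dp; rewrite inE zp orbT.
Qed.

Lemma path_sum_approx (D : set R) F q w (k e : R) x p : path <%R x p ->
  D x -> (forall y, y \in p -> D y) ->
  (forall u v, D u -> D v -> u < v -> `|F u v - k * q u v| <= e * w u v) ->
  `|path_sum F x p - k * path_sum q x p| <= e * path_sum w x p.
Proof.
move=> xp Dx Dp FG; rewrite -!path_sumZ ler_norml.
have H c : c * path_sum w x p = path_sum (fun u v => c * w u v) x p.
  by rewrite path_sumZ.
rewrite -[in - _]mulN1r -path_sumZ lerBrDr lerBlDr -!path_sumD.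
apply/andP; split; apply: (path_sum_le xp Dx Dp) => u v Du Dv uv;
  have := FG u v Du Dv uv; rewrite ler_norml => /andP[]; lra.
Qed.

Lemma big_pairE (T : Type) (idx : T) (op : Monoid.law idx)
    (F : R -> R -> T) x p :
  \big[op/idx]_(1 <= i < size (x :: p)) F (x :: p)`_i.-1 (x :: p)`_i =
  \big[op/idx]_(z <- pairmap F x p) z.
Proof.
rewrite (big_nth idx) size_pairmap /= big_add1 /=.
by apply: eq_big_nat => i /andP[_ ip]; rewrite (nth_pairmap 0).
Qed.

Lemma restrE l s t : restr l s t = s :: rcons (inner l s t) t.
Proof.
rewrite /restr /itv_partitionL /itv_partitionR -filter_predI.
by congr (_ :: rcons _ _); apply: eq_filter => x /=; rewrite andbC.
Qed.

Lemma lam_sumE F l s t :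
  \sum_(1 <= i < size (restr l s t))
    F (restr l s t)`_i.-1 (restr l s t)`_i = lam_sum F l s t.
Proof. by rewrite restrE big_pairE. Qed.

Lemma sorted_inner l s t : sorted <%R l -> sorted <%R (inner l s t).
Proof. exact: (sorted_filter (@lt_trans _ _)). Qed.

Lemma mem_inner l s t x : (x \in inner l s t) = (s < x < t) && (x \in l).
Proof. by rewrite mem_filter. Qed.

Lemma path_inner l s t : sorted <%R l -> s < t ->
  path <%R s (rcons (inner l s t) t).
Proof.
move=> sl st; rewrite rcons_path; apply/andP; split.
  rewrite lt_path_sortedE sorted_inner // andbT.
  by apply/allP => x; rewrite mem_inner => /andP[/andP[]].
have := mem_last s (inner l s t); rewrite inE => /orP[/eqP -> //|].
by rewrite mem_inner => /andP[/andP[]].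
Qed.

Lemma inner_split l s t r : sorted <%R l -> s < t -> t < r ->
  inner l s r =
  inner l s t ++ (if t \in l then [:: t] else [::]) ++ inner l t r.
Proof.
move=> sl st tr; apply: lt_sorted_eq; first exact: sorted_inner.
- have tp : path <%R t (inner l t r).
    by have := path_inner sl tr; rewrite rcons_path => /andP[].
  have sp : path <%R s (inner l s t).
    by have := path_inner sl st; rewrite rcons_path => /andP[].
  suff : path <%R s (inner l s t ++ (if t \in l then [:: t] else [::]) ++
      inner l t r) by apply: path_sorted.
  have lt' : last s (inner l s t) < t.
    by have := path_inner sl st; rewrite rcons_path => /andP[].
  rewrite cat_path sp /=; case: ifP => tl /=; first by rewrite lt' tp.
  case: (inner l t r) tp => //= u v /andP[tu ->].
  by rewrite (lt_trans lt' tu).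
- move=> x; rewrite !mem_cat !mem_inner.
  case: (ltgtP x t) => [xt|tx|->] /=.
  + rewrite (lt_trans xt tr) andbT.
    by case: ifP => tl; rewrite ?inE ?(lt_eqF xt) /= ?orbF.
  + rewrite (lt_trans st tx) andbF /=.
    by case: ifP => tl; rewrite ?inE ?(gt_eqF tx).
  + by rewrite st tr /=; case: ifP => tl; rewrite ?inE ?eqxx.
Qed.

Definition prev_pt l s t : R := last s (inner l s t).
Definition next_pt l t s : R := head s (inner l t s).

(** Refining a partition by [t] replaces the interval around [t] by two and
leaves all others alone, and refines nothing when [t] is a partition point. *)
Lemma lam_sum_split F l s t r : sorted <%R l -> s < t -> t < r ->
  lam_sum F l s t + lam_sum F l t r - lam_sum F l s r =
  if t \in l then 0 else
  F (prev_pt l s t) t + F t (next_pt l t r) - F (prev_pt l s t) (next_pt l t r).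
Proof.
move=> sl st tr; rewrite /lam_sum (inner_split sl st tr) !rcons_cat.
rewrite path_sum_rcons !path_sum_cat -/(prev_pt l s t); case: ifP => _.
  by rewrite !path_sum_cons path_sum_nil /=; lra.
rewrite path_sum_nil /= /next_pt.
by case: (inner l t r) => [|u v] /=; rewrite ?path_sum_cons ?path_sum_nil; lra.
Qed.

Lemma prev_pt_bounds l s t : s < t -> s <= prev_pt l s t < t.
Proof.
move=> st; have := mem_last s (inner l s t); rewrite -/(prev_pt l s t).
rewrite inE => /orP[/eqP ->|]; first by rewrite lexx.
by rewrite mem_inner => /andP[/andP[/ltW -> ->]].
Qed.

Lemma prev_pt_ge l s t x : sorted <%R l -> s < t -> s < x -> x < t ->
  x \in l -> x <= prev_pt l s t.
Proof.
move=> sl st sx xt xl; have := path_inner sl st.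
rewrite rcons_path => /andP[p _].
have xi : x \in inner l s t by rewrite mem_inner sx xt xl.
by have /andP[] := path_lt_bounds p xi.
Qed.

Lemma next_pt_bounds l s t : t < s -> t < next_pt l t s <= s.
Proof.
move=> ts; rewrite /next_pt; case E : (inner l t s) => [|u v] /=.
  by rewrite ts lexx.
have := mem_head u v; rewrite -E mem_inner.
by move=> /andP[/andP[-> /ltW ->]].
Qed.

Lemma next_pt_le l s t x : sorted <%R l -> t < s -> t < x -> x < s ->
  x \in l -> next_pt l t s <= x.
Proof.
move=> sl ts tx xs xl; have : x \in inner l t s by rewrite mem_inner tx xs xl.
rewrite /next_pt; have := sorted_inner t s sl.
case: (inner l t s) => // u v; rewrite inE /= => uv /orP[/eqP -> //|xv].
by have /andP[/ltW] := path_lt_bounds uv xv.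
Qed.

Lemma lam_sum_prev F l s t :
  lam_sum F l s t - F (prev_pt l s t) t = path_sum F s (inner l s t).
Proof. by rewrite /lam_sum path_sum_rcons addrK. Qed.

Lemma lam_sum_next F l s t :
  lam_sum F l t s - F t (next_pt l t s) =
  path_sum F (next_pt l t s) (behead (rcons (inner l t s) s)).
Proof.
rewrite /lam_sum /next_pt; case: (inner l t s) => [|u v] /=;
  by rewrite path_sum_cons addrAC subrr add0r.
Qed.

(** The one-sided comparison holds at points below [t] only; without the
interval that ends at [t], the partition consists of such points. *)
Lemma lam_sum_approx_left (D : set R) F q w (k e : R) l s t : sorted <%R l ->
  s < t -> (forall x, s <= x < t -> D x) ->
  (forall u v, D u -> D v -> u < v -> `|F u v - k * q u v| <= e * w u v) ->
  `|(lam_sum F l s t - F (prev_pt l s t) t) -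
     k * (lam_sum q l s t - q (prev_pt l s t) t)| <=
  e * (lam_sum w l s t - w (prev_pt l s t) t).
Proof.
move=> sl st HD HF; rewrite !lam_sum_prev.
apply: (path_sum_approx _ _ _ HF).
- by have := path_inner sl st; rewrite rcons_path => /andP[].
- by apply: HD; rewrite lexx.
- move=> y; rewrite mem_inner => /andP[/andP[/ltW sy yt] _].
  by apply: HD; rewrite sy.
Qed.

Lemma lam_sum_approx_right (D : set R) F q w (k e : R) l s t : sorted <%R l ->
  t < s -> (forall x, t < x <= s -> D x) ->
  (forall u v, D u -> D v -> u < v -> `|F u v - k * q u v| <= e * w u v) ->
  `|(lam_sum F l t s - F t (next_pt l t s)) -
     k * (lam_sum q l t s - q t (next_pt l t s))| <=
  e * (lam_sum w l t s - w t (next_pt l t s)).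
Proof.
move=> sl ts HD HF; rewrite !lam_sum_next.
have p := path_inner sl ts.
apply: (path_sum_approx _ _ _ HF).
- by rewrite /next_pt; case: (inner l t s) p => [|u v] //= /andP[].
- exact/HD/next_pt_bounds.
- move=> y /mem_behead; rewrite mem_rcons inE => /orP[/eqP ->|].
    by apply: HD; rewrite ts lexx.
  by rewrite mem_inner => /andP[/andP[ty /ltW ys] _]; apply: HD; rewrite ty.
Qed.

Lemma lam_sum_le F G l s t : sorted <%R l -> s < t ->
  (forall u v, s <= u -> u < v -> v <= t -> F u v <= G u v) ->
  lam_sum F l s t <= lam_sum G l s t.
Proof.
move=> sl st FG; apply: (@path_sum_le [set x | s <= x <= t]).
- exact: path_inner.
- by rewrite /= lexx ltW.
- move=> y; rewrite mem_rcons inE mem_inner /= => /orP[/eqP ->|].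
    by rewrite lexx ltW.
  by move=> /andP[/andP[/ltW -> /ltW ->]].
- by move=> u v /= /andP[su _] /andP[_ vt] uv; apply: FG.
Qed.

Lemma lam_sum_eq F G l s t : sorted <%R l -> s < t ->
  (forall u v, s <= u -> u < v -> v <= t -> F u v = G u v) ->
  lam_sum F l s t = lam_sum G l s t.
Proof.
move=> sl st FG; apply/eqP; rewrite eq_le.
by apply/andP; split; apply: lam_sum_le => // u v su uv vt; rewrite FG.
Qed.

Lemma lam_sumD F G l s t :
  lam_sum (fun u v => F u v + G u v) l s t = lam_sum F l s t + lam_sum G l s t.
Proof. exact: path_sumD. Qed.

Lemma lam_sumZ c F l s t :
  lam_sum (fun u v => c * F u v) l s t = c * lam_sum F l s t.
Proof. exact: path_sumZ. Qed.

Lemma lam_sum_telescope (f : R -> R) l s t :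
  lam_sum (fun u v => f v - f u) l s t = f t - f s.
Proof. by rewrite /lam_sum path_sum_telescope last_rcons. Qed.

Lemma lam_sum_ge0 F l s t : sorted <%R l -> s < t ->
  (forall u v, s <= u -> u < v -> v <= t -> 0 <= F u v) ->
  0 <= lam_sum F l s t.
Proof.
move=> sl st F0; rewrite -(subrr (0 : R)) -(lam_sum_telescope (fun=> 0) l s t).
by apply: lam_sum_le => // u v su uv vt; rewrite subrr F0.
Qed.

End Sums.

(** * One-sided neighbourhoods and partitions *)

Section OneSided.
Variable R : realType.
Implicit Types (a b s t x : R) (f : R -> R) (D : set R).

Lemma near_leftP t D : (\forall x \near t^'-, D x) <->
  exists2 s, s < t & forall x, s < x < t -> D x.
Proof.
split=> [[e /= e0 H]|[s st H]].
  exists (t - e) => [|x /andP[x1 x2]]; first by rewrite ltrBlDr ltrDl.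
  by apply: H => //=; rewrite gtr0_norm ?subr_gt0 // ltrBlDr -ltrBlDl.
near=> x; apply: H; apply/andP; split; first by near: x; exact: nbhs_left_gt.
by near: x; exact: nbhs_left_lt.
Unshelve. all: by end_near. Qed.

Lemma near_rightP t D : (\forall x \near t^'+, D x) <->
  exists2 s, t < s & forall x, t < x < s -> D x.
Proof.
split=> [[e /= e0 H]|[s st H]].
  exists (t + e) => [|x /andP[x1 x2]]; first by rewrite ltrDl.
  by apply: H => //=; rewrite distrC gtr0_norm ?subr_gt0 // ltrBlDl.
near=> x; apply: H; apply/andP; split; last by near: x; exact: nbhs_right_lt.
by near: x; exact: nbhs_right_gt.
Unshelve. all: by end_near. Qed.

Lemma near_left_seg t D : (\forall x \near t^'-, D x) ->
  \forall s \near t^'-, forall x, s <= x < t -> D x.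
Proof.
move=> /near_leftP[u ut H]; apply/near_leftP; exists u => // s /andP[us _].
by move=> x /andP[sx xt]; apply: H; rewrite xt andbT (lt_le_trans us).
Qed.

Lemma near_right_seg t D : (\forall x \near t^'+, D x) ->
  \forall s \near t^'+, forall x, t < x <= s -> D x.
Proof.
move=> /near_rightP[u ut H]; apply/near_rightP; exists u => // s /andP[_ su].
by move=> x /andP[tx xs]; apply: H; rewrite tx (le_lt_trans xs).
Qed.

Lemma llimP a b f t : regulated a b f -> a < t <= b ->
  f x @[x --> t^'-] --> llim f t.
Proof. by move=> [H _] /H. Qed.

Lemma rlimP a b f s : regulated a b f -> a <= s < b ->
  f x @[x --> s^'+] --> rlim f s.
Proof. by move=> [_ H] /H. Qed.

Lemma llim_unique f t (y : R) : f x @[x --> t^'-] --> y -> llim f t = y.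
Proof. exact/cvg_lim. Qed.

Lemma rlim_unique f t (y : R) : f x @[x --> t^'+] --> y -> rlim f t = y.
Proof. exact/cvg_lim. Qed.

Lemma ljumpE a f t : a < t -> ljump a f t = f t - llim f t.
Proof. by rewrite /ljump => ->. Qed.

Lemma rjumpE b f t : t < b -> rjump b f t = rlim f t - f t.
Proof. by rewrite /rjump => ->. Qed.

(** A property of intervals that holds near every point, on each side, and
passes to unions of adjacent intervals: the supremum of the [t] with [P a t]
can only be [b]. *)
Lemma interval_induction a b (P : R -> R -> Prop) : a < b ->
  (forall s t r, a <= s -> s < t -> t < r -> r <= b ->
     P s t -> P t r -> P s r) ->
  (forall t, a < t -> t <= b -> \forall s \near t^'-, a <= s -> P s t) ->
  (forall t, a <= t -> t < b -> \forall s \near t^'+, s <= b -> P t s) ->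
  P a b.
Proof.
move=> ab Padd Pl Pr; pose A := [set t | [/\ a < t, t <= b & P a t]].
have [u au Hu] := (near_rightP _ _).1 (Pr a (lexx _) ab).
have am : a < Num.min u b by rewrite lt_min au.
have mu : Num.min u b <= u by rewrite ge_min lexx.
have mb : Num.min u b <= b by rewrite ge_min lexx orbT.
have [x0 Ax0] : A !=set0.
  exists ((a + Num.min u b) / 2); rewrite /A /=.
  by split; [lra|lra|apply: Hu; [apply/andP; split|]; lra].
have supA : has_sup A by split; [exists x0|exists b => x []].
set c := sup A.
have ac : a < c.
  case: (Ax0) => ax0 _ _; apply: (lt_le_trans ax0).
  exact: (ub_le_sup supA.2 Ax0).
have cb : c <= b by apply: ge_sup; [exists x0|move=> x []].
have Pac : P a c.
  have [v vc Hv] := (near_leftP _ _).1 (Pl c ac cb).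
  have cv0 : 0 < c - v by rewrite subr_gt0.
  have [t At vt] := sup_adherent cv0 supA.
  have tc : t <= c by exact: (ub_le_sup supA.2 At).
  case: At => at_ tb Pat; move: tc; rewrite le_eqVlt => /orP[/eqP <- //|tc].
  apply: (Padd a t c) => //; apply: Hv; last exact: ltW.
  by rewrite tc andbT; move: vt; rewrite -/c; lra.
move: cb; rewrite le_eqVlt => /orP[/eqP <- //|cb].
have [w cw Hw] := (near_rightP _ _).1 (Pr c (ltW ac) cb).
have cm : c < Num.min w b by rewrite lt_min cw.
have mw : Num.min w b <= w by rewrite ge_min lexx.
have mb' : Num.min w b <= b by rewrite ge_min lexx orbT.
have Ar : A ((c + Num.min w b) / 2).
  rewrite /A /=; split; [lra|lra|].
  by apply: (Padd a c) => //; [lra|lra|apply: Hw; [apply/andP; split|]; lra].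
have := ub_le_sup supA.2 Ar; rewrite -/c; lra.
Qed.

End OneSided.

Section Approx.
Variable R : realType.
Implicit Types (u : nat -> R) (v r : R).

Lemma cvg_lim_eq (T : Type) (A : set_system T) (f : T -> R) (l l' : R) :
  l = l' -> f x @[x --> A] --> l -> f x @[x --> A] --> l'.
Proof. by move=> ->. Qed.

(** No limit of [u] is assumed: [r] bounds how far [u] oscillates around [v] in
the long run. Unlike convergence, such bounds can be proved locally and then
added over adjacent intervals. *)
Definition approx u v r :=
  forall eta : R, 0 < eta -> \forall m \near \oo, `|u m - v| <= r + eta.

Lemma approx_cvg u v r (L : R) : u m @[m --> \oo] --> L -> approx u v r ->
  `|L - v| <= r.
Proof.
move=> uL uv; apply/ler_addgt0Pr => e e0.
have : `|u m - v| @[m --> \oo] --> `|L - v|.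
  by apply: cvg_norm; apply: cvgB => //; exact: cvg_cst.
by move=> /cvgr_to_le; apply; exact: uv.
Qed.

Lemma approxD u1 u2 u v1 v2 r1 r2 :
  (u1 m + u2 m - u m) @[m --> \oo] --> (0 : R) ->
  approx u1 v1 r1 -> approx u2 v2 r2 -> approx u (v1 + v2) (r1 + r2).
Proof.
move=> /cvgr0Pnorm_lt u12 H1 H2 e e0.
have e3 : 0 < e / 3 by rewrite divr_gt0.
have := u12 _ e3; have := H1 _ e3; have := H2 _ e3.
apply: filterS3 => m; rewrite ltr_norml !ler_norml.
move=> /andP[? ?] /andP[? ?] /andP[? ?].
by apply/andP; split; lra.
Qed.

Lemma approx_ex_cvg u : (forall e : R, 0 < e -> exists v, approx u v e) ->
  cvg (u m @[m --> \oo]).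
Proof.
move=> H; apply/cauchy_cvgP/cauchy_exP => e e0.
have e2 : 0 < e / 3 by rewrite divr_gt0.
have [v /(_ _ e2) Hv] := H _ e2; exists v.
apply: filterS Hv => m /= Hm; rewrite /ball /= distrC.
by apply: le_lt_trans Hm _; lra.
Qed.

(** The sequences [eF], [eQ], [ew] are the terms of the interval adjacent to the
point at which the comparison is made. They are not compared with one another
but have limits of their own, which account for the jump at that point. *)
Lemma approx_edge (uF uq uw eF eQ ew : nat -> R) (k e A A' B B' c : R) :
  (\forall m \near \oo,
     `|(uF m - eF m) - k * (uq m - eQ m)| <= e * (uw m - ew m)) ->
  uq m @[m --> \oo] --> A -> eQ m @[m --> \oo] --> A' ->
  uw m @[m --> \oo] --> B -> ew m @[m --> \oo] --> B' ->
  eF m @[m --> \oo] --> c ->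
  approx uF (c + k * (A - A')) (e * (B - B')).
Proof.
move=> H HA HA' HB HB' Hc h h0.
have L1 : (e * (uw m - ew m)) @[m --> \oo] --> e * (B - B').
  by apply: cvgM; [exact: cvg_cst|exact: cvgB].
have L2 : (eF m + k * (uq m - eQ m)) @[m --> \oo] --> c + k * (A - A').
  by apply: cvgD => //; apply: cvgM; [exact: cvg_cst|exact: cvgB].
have h2 : 0 < h / 2 by rewrite divr_gt0.
have H1 := cvgr_dist_le _ _ L1 _ h2.
have H2 := cvgr_dist_le _ _ L2 _ h2.
near=> m.
have : `|(uF m - eF m) - k * (uq m - eQ m)| <= e * (uw m - ew m) by near: m.
have : `|e * (B - B') - e * (uw m - ew m)| <= h / 2.
  by near: m; exact: H1.
have : `|c + k * (A - A') - (eF m + k * (uq m - eQ m))| <= h / 2.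
  by near: m; exact: H2.
rewrite !ler_norml => /andP[? ?] /andP[? ?] /andP[? ?].
by apply/andP; split; lra.
Unshelve. all: by end_near. Qed.

End Approx.

Section Partitions.
Variables (R : realType) (a b : R) (lam : nat -> seq R).
Hypothesis hlam : nested_partitions a b lam.

Lemma lam_sorted m : sorted <%R (lam m).
Proof. by case: hlam => /(_ m)[/path_sorted]. Qed.

Lemma lam_gt m x : x \in lam m -> a < x.
Proof. by case: hlam => /(_ m)[p _] _ _ /(path_lt_bounds p) /andP[]. Qed.

Lemma lam_nested m n x : (m <= n)%N -> x \in lam m -> x \in lam n.
Proof.
move=> /subnK <- xm; elim: (n - m)%N => // k IH.
case: hlam => _ /(_ (k + m)%N x) H _; rewrite addSn.
have := H; rewrite !inE IH orbT => /(_ isT) /orP[/eqP xa|//].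
by have := lam_gt xm; rewrite xa ltxx.
Qed.

Lemma lam_union t : union_partitions a lam t -> a < t ->
  \forall m \near \oo, t \in lam m.
Proof.
move=> [m]; rewrite inE => /orP[/eqP ->|tm _]; first by rewrite ltxx.
by exists m => // n mn; exact: lam_nested tm.
Qed.

Lemma lam_dense s t : a <= s -> s < t -> t <= b ->
  exists2 x, s < x < t & \forall m \near \oo, x \in lam m.
Proof.
move=> as_ st tb; case: (hlam) => _ _ dense.
have cl : closure (union_partitions a lam) ((s + t) / 2).
  by apply: dense; rewrite /=; apply/andP; split; lra.
have [|x [Ux stx]] := cl [set x | s < x < t].
  have : ((s + t) / 2) \in `]s, t[ by rewrite in_itv /=; apply/andP; split; lra.
  by move=> /near_in_itvoo; apply: filterS => x; rewrite in_itv.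
exists x => //; apply: lam_union => //.
by case/andP: stx => sx _; apply: le_lt_trans sx.
Qed.

Lemma prev_pt_cvg s t : a <= s -> s < t -> t <= b ->
  prev_pt (lam m) s t @[m --> \oo] --> t^'-.
Proof.
move=> as_ st tb A /near_leftP[u ut HA].
have aus : a <= Num.max u s by rewrite le_max as_ orbT.
have ust : Num.max u s < t by rewrite gt_max ut st.
have [x /andP[+ xt] xm] := lam_dense aus ust tb.
rewrite gt_max => /andP[ux sx].
apply: filterS xm => m xm; apply: HA.
have /andP[_ ->] := prev_pt_bounds (lam m) st; rewrite andbT.
by apply: (lt_le_trans ux); apply: prev_pt_ge => //; exact: lam_sorted.
Qed.

Lemma next_pt_cvg s t : a <= t -> t < s -> s <= b ->
  next_pt (lam m) t s @[m --> \oo] --> t^'+.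
Proof.
move=> at_ ts sb A /near_rightP[u tu HA].
have usb : Num.min u s <= b by rewrite ge_min sb orbT.
have tus : t < Num.min u s by rewrite lt_min tu ts.
have [x /andP[tx +] xm] := lam_dense at_ tus usb.
rewrite lt_min => /andP[xu xs].
apply: filterS xm => m xm; apply: HA.
have /andP[-> _] := next_pt_bounds (lam m) ts; rewrite /=.
by apply: (le_lt_trans _ xu); apply: next_pt_le => //; exact: lam_sorted.
Qed.

End Partitions.

(** * Interval functions: from local comparison to convergence *)

Section Burkill.
Variables (R : realType) (a b : R) (lam : nat -> seq R).
Implicit Types (F q w : R -> R -> R) (G V W : R -> R) (s t : R).

(** [G] is the indefinite integral of the interval function [F] in the sense of
Burkill, along the given partitions. The quadratic variation, the left Cauchy
integral and the generator are the cases [(f v - f u)^2],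
[g u * (f v - f u)] and [U v u - 1] of [F u v]. The conditions on the jumps are
stated through limits of [F], which makes them uniform in all the cases. *)
Definition burkill F G :=
  [/\ regulated a b G,
      forall s t, a <= s -> s < t -> t <= b ->
        lam_sum F (lam m) s t @[m --> \oo] --> G t - G s,
      forall t, a < t <= b -> F x t @[x --> t^'-] --> G t - llim G t &
      forall s, a <= s < b -> F s y @[y --> s^'+] --> rlim G s - G s].

(** The last clause says that [F] is continuous on the right at a point that is
never a partition point: the interval around such a point then contributes in
the limit as if the point were its right end. *)
Definition edge_limits F (Fl Fr : R -> R) :=
  [/\ forall t, a < t <= b -> F x t @[x --> t^'-] --> Fl t,
      forall t, a <= t < b -> F t y @[y --> t^'+] --> Fr t &
      forall t, a < t < b -> ~ union_partitions a lam t ->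
        Fr t = 0 /\ F z.1 z.2 @[z --> filter_prod t^'- t^'+] --> Fl t].

(** [A] is a one-sided neighbourhood filter of a point; [k] may depend on the
point and on the side. *)
Definition comparable_along (A : set_system R) F q w (k : R) :=
  forall e : R, 0 < e -> exists2 D : set R, A D &
    forall u v, D u -> D v -> u < v -> `|F u v - k * q u v| <= e * w u v.

Section LocalToGlobal.
Hypothesis hlam : nested_partitions a b lam.
Variables (F q w : R -> R -> R) (V W Fl Fr kl kr : R -> R).
Hypothesis hq : burkill q V.
Hypothesis hw : burkill w W.
Hypothesis w0 : forall u v, a <= u -> u < v -> v <= b -> 0 <= w u v.
Hypothesis hF : edge_limits F Fl Fr.
Hypothesis hl : forall t, a < t <= b -> comparable_along t^'- F q w (kl t).
Hypothesis hr : forall t, a <= t < b -> comparable_along t^'+ F q w (kr t).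

Let S s t m := lam_sum F (lam m) s t.

(** The interval ending at [t] contributes [Fl t]; the others are compared with
[q], whose sums over them tend to the increment of [V] short of its jump. *)
Lemma approx_left t (e : R) : a < t <= b -> 0 < e ->
  \forall s \near t^'-, a <= s ->
    approx (S s t) (Fl t + kl t * (llim V t - V s)) (e * (llim W t - W s)).
Proof.
move=> atb e0; have [D tD HD] := hl atb e0.
case/andP: (atb) => at_ tb.
near=> s => as_.
have st : s < t by near: s; exact: nbhs_left_lt.
have sD : forall x, s <= x < t -> D x by near: s; exact: near_left_seg.
have p := prev_pt_cvg hlam as_ st tb.
case: hq => _ qs ql _; case: hw => _ ws wl _; case: hF => Fs _ _.
have -> : llim V t - V s = (V t - V s) - (V t - llim V t) by lra.
have -> : llim W t - W s = (W t - W s) - (W t - llim W t) by lra.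
apply: (@approx_edge _ _ (fun m => lam_sum q (lam m) s t)
  (fun m => lam_sum w (lam m) s t) (fun m => F (prev_pt (lam m) s t) t)
  (fun m => q (prev_pt (lam m) s t) t) (fun m => w (prev_pt (lam m) s t) t)).
- near=> m; apply: (lam_sum_approx_left (lam_sorted hlam m) st sD HD).
- exact: qs.
- exact: cvg_comp p (ql _ atb).
- exact: ws.
- exact: cvg_comp p (wl _ atb).
- exact: cvg_comp p (Fs _ atb).
Unshelve. all: by end_near. Qed.

Lemma approx_right t (e : R) : a <= t < b -> 0 < e ->
  \forall s \near t^'+, s <= b ->
    approx (S t s) (Fr t + kr t * (V s - rlim V t)) (e * (W s - rlim W t)).
Proof.
move=> atb e0; have [D tD HD] := hr atb e0.
case/andP: (atb) => at_ tb.
near=> s => sb.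
have st : t < s by near: s; exact: nbhs_right_gt.
have sD : forall x, t < x <= s -> D x by near: s; exact: near_right_seg.
have p := next_pt_cvg hlam at_ st sb.
case: hq => _ qs _ qr; case: hw => _ ws _ wr; case: hF => _ Fs _.
have -> : V s - rlim V t = (V s - V t) - (rlim V t - V t) by lra.
have -> : W s - rlim W t = (W s - W t) - (rlim W t - W t) by lra.
apply: (@approx_edge _ _ (fun m => lam_sum q (lam m) t s)
  (fun m => lam_sum w (lam m) t s) (fun m => F t (next_pt (lam m) t s))
  (fun m => q t (next_pt (lam m) t s)) (fun m => w t (next_pt (lam m) t s))).
- near=> m; apply: (lam_sum_approx_right (lam_sorted hlam m) st sD HD).
- exact: qs.
- exact: cvg_comp p (qr _ atb).
- exact: ws.
- exact: cvg_comp p (wr _ atb).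
- exact: cvg_comp p (Fs _ atb).
Unshelve. all: by end_near. Qed.

Lemma control_ljump t : a < t <= b -> llim W t <= W t.
Proof.
case: hw => _ _ wl _ atb; have := wl _ atb; rewrite -subr_ge0.
move/cvgr_to_ge; apply; case/andP: atb => at_ tb; near=> x.
have xt : x < t by near: x; exact: nbhs_left_lt.
by apply: w0 => //; near: x; exact: nbhs_left_ge.
Unshelve. all: by end_near. Qed.

Lemma control_rjump t : a <= t < b -> W t <= rlim W t.
Proof.
case: hw => _ _ _ wr atb; have := wr _ atb; rewrite -subr_ge0.
move/cvgr_to_ge; apply; case/andP: atb => at_ tb; near=> x.
have tx : t < x by near: x; exact: nbhs_right_gt.
by apply: w0 => //; near: x; exact: nbhs_right_ltW.
Unshelve. all: by end_near. Qed.

Lemma control_le s t : a <= s -> s < t -> t <= b -> W s <= W t.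
Proof.
case: hw => _ ws _ _ as_ st tb; have := ws _ _ as_ st tb; rewrite -subr_ge0.
move/cvgr_to_ge; apply; near=> m.
apply: lam_sum_ge0 => // [|u v su uv vt]; first exact: (lam_sorted hlam).
by apply: w0 => //; [exact: le_trans su|exact: le_trans tb].
Unshelve. all: by end_near. Qed.

(** A cut point outside the partitions is eventually isolated in an interval
whose ends tend to it from both sides; on the right [F] is continuous there,
so that cutting changes nothing in the limit. *)
Lemma lam_sum_additive s t r : a <= s -> s < t -> t < r -> r <= b ->
  (S s t m + S t r m - S s r m) @[m --> \oo] --> 0.
Proof.
move=> as_ st tr rb; have at_ : a < t := le_lt_trans as_ st.
have tb : t < b := lt_le_trans tr rb.
have E m := lam_sum_split F (lam_sorted hlam m) st tr.
have [Ut|Ut] := pselect (union_partitions a lam t).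
  apply: cvg_near_cst; have := lam_union hlam Ut at_.
  by apply: filterS => m tm; rewrite /S E tm.
have tm m : t \in lam m = false.
  by apply/negP => tm; apply: Ut; exists m; rewrite inE tm orbT.
have {}E m : S s t m + S t r m - S s r m =
   F (prev_pt (lam m) s t) t + F t (next_pt (lam m) t r)
   - F (prev_pt (lam m) s t) (next_pt (lam m) t r) by rewrite /S E tm.
rewrite (eq_cvg _ _ E).
have pl := prev_pt_cvg hlam as_ st (ltW tb).
have pr := next_pt_cvg hlam (ltW at_) tr rb.
case: hF => F1 F2 /(_ t _ Ut)[|Fr0 F3]; first by rewrite at_ tb.
apply: (@cvg_lim_eq _ _ _ _ (Fl t + Fr t - Fl t)).
  by rewrite Fr0 addr0 subrr.
have {}F1 := F1 t (ltac:(by rewrite at_ ltW)).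
have {}F2 := F2 t (ltac:(by rewrite tb ltW)).
have C1 : F (prev_pt (lam m) s t) t @[m --> \oo] --> Fl t.
  exact: cvg_comp pl F1.
have C2 : F t (next_pt (lam m) t r) @[m --> \oo] --> Fr t.
  exact: cvg_comp pr F2.
have C3 : F (prev_pt (lam m) s t) (next_pt (lam m) t r) @[m --> \oo] --> Fl t.
  exact: cvg_comp (cvg_pair pl pr) F3.
exact: cvgB (cvgD C1 C2) C3.
Qed.

Lemma approx_local_to_global (e : R) s t : 0 < e -> a <= s -> s < t -> t <= b ->
  exists v, approx (S s t) v (e * (W t - W s)).
Proof.
move=> e0 as_ st tb.
pose P x y := exists v, approx (S x y) v (e * (W y - W x)).
apply: (@interval_induction _ s t P) =>
  // [x y z sx xy yz zt [v1 H1] [v2 H2]||].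
- exists (v1 + v2).
  have -> : e * (W z - W x) = e * (W y - W x) + e * (W z - W y) by lra.
  apply: approxD H1 H2; apply: lam_sum_additive => //.
    exact: le_trans sx.
  exact: le_trans tb.
- move=> y sy yt; have ayb : a < y <= b.
    by rewrite (le_lt_trans as_ sy) (le_trans yt tb).
  apply: filterS (approx_left ayb e0) => x H sx.
  exists (Fl y + kl y * (llim V y - V x)) => h h0.
  apply: filterS (H (le_trans as_ sx) h h0) => m /le_trans; apply.
  by rewrite lerD2r ler_pM2l // lerD2r control_ljump.
- move=> y sy yt; have ayb : a <= y < b.
    by rewrite (le_trans as_ sy) (lt_le_trans yt tb).
  apply: filterS (approx_right ayb e0) => x H xt.
  exists (Fr y + kr y * (V x - rlim V y)) => h h0.
  apply: filterS (H (le_trans xt tb) h h0) => m /le_trans; apply.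
  by rewrite lerD2r ler_pM2l // lerB // control_rjump.
Qed.

Lemma lam_sum_is_cvg s t : a <= s -> s < t -> t <= b ->
  cvg (S s t m @[m --> \oo]).
Proof.
move=> as_ st tb; apply: approx_ex_cvg => e e0.
have W0 : 0 < W t - W s + 1 by have := control_le as_ st tb; lra.
have [v Hv] := approx_local_to_global (divr_gt0 e0 W0) as_ st tb.
exists v => h h0; apply: filterS (Hv h h0) => m /le_trans; apply.
rewrite lerD2r mulrAC ler_pdivrMr // ler_pM2l //; lra.
Qed.

Let G t := if a < t then lim (S a t m @[m --> \oo]) else 0.

Lemma lam_sum_cvg s t : a <= s -> s < t -> t <= b ->
  S s t m @[m --> \oo] --> G t - G s.
Proof.
move=> as_ st tb; have at_ : a < t := le_lt_trans as_ st.
move: as_; rewrite /G at_ le_eqVlt => /orP[/eqP<-|as_].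
  by rewrite ltxx subr0; apply: lam_sum_is_cvg.
rewrite as_; have sb := le_trans (ltW st) tb.
have C1 := lam_sum_is_cvg (lexx a) at_ tb.
have C2 := lam_sum_is_cvg (lexx a) as_ sb.
have C3 := lam_sum_additive (lexx a) as_ st tb.
have -> : S s t = fun m => (S a s m + S s t m - S a t m) + S a t m - S a s m.
  by apply/funext => m; lra.
rewrite -[X in _ --> X]add0r addrA.
by apply: cvgB => //; apply: cvgD.
Qed.

(** The estimate near [t] with [e = 1] is enough here, as its right-hand side
vanishes when [s] tends to [t]. *)
Lemma cvg_ljump t : a < t <= b -> G x @[x --> t^'-] --> G t - Fl t.
Proof.
move=> atb; case/andP: (atb) => at_ tb.
pose B s := `|kl t| * `|llim V t - V s| + `|llim W t - W s|.
have B0 : B s @[s --> t^'-] --> 0.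
  apply: (@cvg_lim_eq _ _ _ _
      (`|kl t| * `|llim V t - llim V t| + `|llim W t - llim W t|)).
    by rewrite !subrr normr0 mulr0 addr0.
  case: hq => /llimP/(_ atb) Vt _ _ _; case: hw => /llimP/(_ atb) Wt _ _ _.
  by apply: cvgD; [apply: cvgM; first exact: cvg_cst|];
     apply: cvg_norm; apply: cvgB => //; exact: cvg_cst.
apply/cvgrPdist_le => e e0.
have Be : \forall s \near t^'-, `|0 - B s| <= e by exact: cvgr_dist_le B0 _ e0.
near=> s.
have as_ : a <= s by near: s; exact: nbhs_left_ge.
have st : s < t by near: s; exact: nbhs_left_lt.
have H : a <= s -> approx (S s t) (Fl t + kl t * (llim V t - V s))
    (1 * (llim W t - W s)) by near: s; exact: approx_left.
have := approx_cvg (lam_sum_cvg as_ st tb) (H as_); rewrite mul1r => HH.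
have Bs : `|0 - B s| <= e by near: s.
apply: le_trans Bs; rewrite sub0r normrN; apply: le_trans (ler_norm _).
have -> : G t - Fl t - G s = (G t - G s - (Fl t + kl t * (llim V t - V s)))
   + kl t * (llim V t - V s) by lra.
rewrite /B -normrM [leRHS]addrC; apply: (le_trans (ler_normD _ _)).
rewrite lerD2r.
by apply: (le_trans HH); exact: ler_norm.
Unshelve. all: by end_near. Qed.

Lemma cvg_rjump t : a <= t < b -> G x @[x --> t^'+] --> G t + Fr t.
Proof.
move=> atb; case/andP: (atb) => at_ tb.
pose B s := `|kr t| * `|V s - rlim V t| + `|W s - rlim W t|.
have B0 : B s @[s --> t^'+] --> 0.
  apply: (@cvg_lim_eq _ _ _ _
      (`|kr t| * `|rlim V t - rlim V t| + `|rlim W t - rlim W t|)).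
    by rewrite !subrr normr0 mulr0 addr0.
  case: hq => /rlimP/(_ atb) Vt _ _ _; case: hw => /rlimP/(_ atb) Wt _ _ _.
  by apply: cvgD; [apply: cvgM; first exact: cvg_cst|];
     apply: cvg_norm; apply: cvgB => //; exact: cvg_cst.
apply/cvgrPdist_le => e e0.
have Be : \forall s \near t^'+, `|0 - B s| <= e by exact: cvgr_dist_le B0 _ e0.
near=> s.
have sb : s <= b by near: s; exact: nbhs_right_ltW.
have st : t < s by near: s; exact: nbhs_right_gt.
have H : s <= b -> approx (S t s) (Fr t + kr t * (V s - rlim V t))
    (1 * (W s - rlim W t)) by near: s; exact: approx_right.
have := approx_cvg (lam_sum_cvg at_ st sb) (H sb); rewrite mul1r => HH.
have Bs : `|0 - B s| <= e by near: s.
apply: le_trans Bs; rewrite sub0r normrN; apply: le_trans (ler_norm _).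
rewrite distrC.
have -> : G s - (G t + Fr t) = (G s - G t - (Fr t + kr t * (V s - rlim V t)))
   + kr t * (V s - rlim V t) by lra.
rewrite /B -normrM [leRHS]addrC; apply: (le_trans (ler_normD _ _)).
rewrite lerD2r.
by apply: (le_trans HH); exact: ler_norm.
Unshelve. all: by end_near. Qed.

(** Existence of the integral: the oscillation of the sums is at most [e] times
an increment of [W], for each [e]. *)
Theorem burkill_exists : exists G, burkill F G.
Proof.
exists G; case: (hF) => Fs Fr' _; split.
- split=> t /[dup] atb.
    by move=> /cvg_ljump Gt; apply/cvg_ex; exists (G t - Fl t).
  by move=> /cvg_rjump Gt; apply/cvg_ex; exists (G t + Fr t).
- exact: lam_sum_cvg.
- move=> t atb; rewrite (llim_unique (cvg_ljump atb)).
  by rewrite subKr; exact: Fs.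
- move=> t atb; rewrite (rlim_unique (cvg_rjump atb)).
  by rewrite addrAC subrr add0r; exact: Fr'.
Qed.

(** When [F] is negligible with respect to [w] near every point and has no
edge contribution, its sums over a small interval are at most a small multiple
of the increment of [W]; these bounds add up. *)
Theorem burkill_negligible s t :
  (forall x, a < x <= b -> Fl x = 0 /\ kl x = 0) ->
  (forall x, a <= x < b -> Fr x = 0 /\ kr x = 0) ->
  a <= s -> s < t -> t <= b ->
  lam_sum F (lam m) s t @[m --> \oo] --> (0 : R).
Proof.
move=> l0 r0 as_ st tb; have C := lam_sum_cvg as_ st tb.
suff H (e : R) : 0 < e -> `|G t - G s| <= e * (W t - W s).
  suff G0 : G t - G s = 0 by rewrite -G0.
  apply/eqP; rewrite -normr_le0; apply/ler_addgt0Pr => e e0; rewrite add0r.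
  have W0 : 0 < W t - W s + 1 by have := control_le as_ st tb; lra.
  apply: (le_trans (H _ (divr_gt0 e0 W0))).
  rewrite mulrAC ler_pdivrMr // ler_pM2l //; lra.
move=> e0; pose P x y := `|G y - G x| <= e * (W y - W x).
apply: (@interval_induction _ s t P) => // [x y z _ _ _ _|y sy yt|y sy yt].
- rewrite /P => H1 H2.
  have -> : G z - G x = (G y - G x) + (G z - G y) by lra.
  have -> : e * (W z - W x) = e * (W y - W x) + e * (W z - W y) by lra.
  by apply: (le_trans (ler_normD _ _)); exact: lerD.
- have ayb : a < y <= b by rewrite (le_lt_trans as_ sy) (le_trans yt tb).
  have [Fy ky] := l0 _ ayb; have := approx_left ayb e0.
  rewrite Fy ky; move=> Hy; near=> x => sx.
  have ax := le_trans as_ sx.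
  have xy : x < y by near: x; exact: nbhs_left_lt.
  have H : a <= x -> approx (S x y) (0 + 0 * (llim V y - V x))
      (e * (llim W y - W x)) by near: x.
  have := approx_cvg (lam_sum_cvg ax xy (le_trans yt tb)) (H ax).
  rewrite mul0r addr0 subr0 => /le_trans; apply.
  by rewrite ler_pM2l // lerD2r control_ljump.
- have ayb : a <= y < b by rewrite (le_trans as_ sy) (lt_le_trans yt tb).
  have [Fy ky] := r0 _ ayb; have := approx_right ayb e0.
  rewrite Fy ky; move=> Hy; near=> x => xt.
  have xb := le_trans xt tb.
  have xy : y < x by near: x; exact: nbhs_right_gt.
  have H : x <= b -> approx (S y x) (0 + 0 * (V x - rlim V y))
      (e * (W x - rlim W y)) by near: x.
  have := approx_cvg (lam_sum_cvg (le_trans as_ sy) xy xb) (H xb).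
  rewrite mul0r addr0 subr0 => /le_trans; apply.
  by rewrite ler_pM2l // lerB // control_rjump.
Unshelve. all: by end_near. Qed.

End LocalToGlobal.
End Burkill.

(** * Second-order estimates for exp and ln *)

Section Estimates.
Variable R : realType.
Implicit Types (x y r d e w : R).

(** By the mean value theorem [phi r] is [r] times a value of the derivative
between 0 and [r]. *)
Lemma cubic_bound (phi dphi : R -> R) r :
  (forall x, `|x| <= 2^-1 -> is_derive x (1 : R) phi (dphi x)) ->
  (forall x, `|x| <= 2^-1 -> `|dphi x| <= 2 * x ^+ 2) ->
  phi 0 = 0 -> `|r| <= 2^-1 -> `|phi r| <= 2 * `|r| ^+ 3.
Proof.
move=> D B phi0 r2.
have small x : `|x| <= `|r| -> `|x| <= 2^-1 by move=> /le_trans; apply.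
suff [c cr ->] : exists2 c, `|c| <= `|r| & `|phi r| = `|dphi c| * `|r|.
  apply: (@le_trans _ _ (2 * c ^+ 2 * `|r|)).
    by apply: ler_wpM2r => //; apply: B; exact: small.
  rewrite [`|r| ^+ 3]exprSr mulrA; apply: ler_wpM2r => //.
  rewrite ler_pM2l // -[c ^+ 2]real_normK ?num_real //.
  by rewrite ler_pXn2r // nnegrE.
have mvt x y : x <= y -> (forall z, x <= z <= y -> `|z| <= `|r|) ->
    exists2 c, `|c| <= `|r| & phi y - phi x = dphi c * (y - x).
  move=> xy H; have [z||c] := @MVT_segment R phi dphi x y xy.
  - by rewrite in_itv /= => /andP[/ltW xz /ltW zy]; apply/D/small/H; rewrite xz.
  - apply: derivable_within_continuous => z; rewrite in_itv /= => zxy.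
    by have [] := D z (small _ (H _ zxy)).
  - by rewrite in_itv /= => cxy E; exists c => //; exact: H.
have [r0|r0] := lerP 0 r.
  have [|z /andP[z0 zr]|c cr E] := mvt 0 r.
  - by [].
  - by rewrite !ger0_norm.
  - by exists c => //; move: E; rewrite phi0 !subr0 => ->; rewrite normrM.
have [|z /andP[rz z0]|c cr E] := mvt r 0.
- exact: ltW.
- by rewrite !ler0_norm ?lerN2 // ltW.
- by exists c => //; rewrite -normrN -[- _]add0r -phi0 E normrM add0r normrN.
Qed.

Lemma expR_taylor2 r : `|r| <= 2^-1 ->
  `|expR r - 1 - r - r ^+ 2 / 2| <= 2 * `|r| ^+ 3.
Proof.
move=> r2; apply: (@cubic_bound (fun x => expR x - 1 - x - x ^+ 2 / 2)
  (fun x => expR x - 1 - x)) => // [x _|x x2|].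
- by apply: is_derive_eq; rewrite /GRing.scale /=; field.
- have E1 := expR_ge1Dx x; have E2 := expR_ge1Dx (- x).
  have E0 := expR_gt0 x.
  have E3 : expR x * (1 - x) <= 1 by rewrite -[leRHS](expRxMexpNx_1 x) ler_pM2l.
  move: x2; rewrite !ler_norml => /andP[? ?].
  by apply/andP; split; nra.
- by rewrite expR0 expr0n /=; lra.
Qed.

(** What a sum of increments [r] has in excess of the logarithm of the product
of the factors [1 + r]. *)
Definition log_defect r := r - ln (1 + r).

Lemma log_defect_taylor2 r : `|r| <= 2^-1 ->
  `|log_defect r - r ^+ 2 / 2| <= 2 * `|r| ^+ 3.
Proof.
move=> r2; apply: (@cubic_bound (fun x => log_defect x - x ^+ 2 / 2)
  (fun x => 1 - (1 + x)^-1 - x)) => // [x x2|x x2|].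
- have x1 : 0 < 1 + x by move: x2; rewrite ler_norml => /andP[]; lra.
  have D : is_derive (1 + x) (1 : R) (@ln R) (1 + x)^-1 by exact: is_derive1_ln.
  have D2 : is_derive x (1 : R) (fun y : R => ln (1 + y)) ((1 + x)^-1).
    have := @is_derive1_comp R (@ln R) (fun y => 1 + y) x _ 1 D _.
    rewrite mulr1; apply; apply: is_derive_eq; lra.
  rewrite /log_defect; apply: is_derive_eq; rewrite /GRing.scale /=; field; lra.
- move: x2; rewrite ler_norml => /andP[? ?].
  have x1 : 0 < 1 + x by lra.
  have -> : 1 - (1 + x)^-1 - x = - (x ^+ 2 / (1 + x)) by field; lra.
  have q0 : 0 <= x ^+ 2 / (1 + x) by rewrite divr_ge0 ?sqr_ge0 ?ltW.
  rewrite normrN ger0_norm //.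
  rewrite ler_pdivrMr //; have := sqr_ge0 x; nra.
- by rewrite /log_defect addr0 ln1 expr0n /=; lra.
Qed.

Lemma log_defect_ge0 r : 0 < 1 + r -> 0 <= log_defect r.
Proof. by move=> r1; rewrite subr_ge0 le_ln1Dx //; lra. Qed.

Lemma log_defect0 : log_defect 0 = 0.
Proof. by rewrite /log_defect addr0 ln1 subr0. Qed.

Lemma log_defect_expR x : log_defect (expR x - 1) = expR x - 1 - x.
Proof. by rewrite /log_defect subrKC expRK. Qed.

(** [ln y - ln x] lies between [(y - x) / y] and [(y - x) / x], because
[ln z <= z - 1]. *)
Lemma ln_diff_sqr x y w e : 0 < x -> 0 < y ->
  `|x ^- 2 - w| <= e -> `|y ^- 2 - w| <= e ->
  `|(ln y - ln x) ^+ 2 - w * (y - x) ^+ 2| <= e * (y - x) ^+ 2.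
Proof.
move=> x0 y0.
have L (u v : R) : 0 < u -> 0 < v -> ln v - ln u <= (v - u) / u.
  move=> u0 v0; rewrite -ln_div ?posrE // mulrBl divff ?gt_eqF //.
  have := le_ln1Dx (x := v / u - 1).
  by rewrite subrKC; apply; have := divr_gt0 v0 u0; lra.
wlog xy : x y x0 y0 / x <= y => [H|].
  have [xy|/ltW yx] := lerP x y; first exact: H.
  by move=> H1 H2; rewrite -sqrrN opprB -[(y - x) ^+ 2]sqrrN opprB; exact: H.
have L1 := L x y x0 y0; have := L y x y0 x0.
rewrite -opprB -[x - y]opprB mulNr lerN2 => L2.
have d0 : 0 <= y - x by rewrite subr_ge0.
have h1 : 0 <= (y - x) / y by rewrite divr_ge0 // ltW.
have A1 : (ln y - ln x) ^+ 2 <= ((y - x) / x) ^+ 2.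
  by rewrite ler_pXn2r // nnegrE ?(le_trans h1 L2) // divr_ge0 // ltW.
have A2 : ((y - x) / y) ^+ 2 <= (ln y - ln x) ^+ 2.
  by rewrite ler_pXn2r // nnegrE (le_trans h1 L2).
move: A1 A2; rewrite !exprMn !exprVn; set d2 := (y - x) ^+ 2.
have : 0 <= d2 by exact: sqr_ge0.
move: (x ^- 2) (y ^- 2) ((ln y - ln x) ^+ 2) => X Y L3 ? ? ?.
rewrite !ler_norml => /andP[? ?] /andP[? ?]; apply/andP; split; nra.
Qed.

End Estimates.

(** * Stability of integrability and local comparisons *)

Section Algebra.
Variables (R : realType) (a b : R) (lam : nat -> seq R).
Implicit Types (F : R -> R -> R) (G p : R -> R) (s t : R).

Lemma regulatedD f g : regulated a b f -> regulated a b g ->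
  regulated a b (fun x => f x + g x).
Proof.
by move=> [fl fr] [gl gr]; split=> t tab; apply: is_cvgD; auto.
Qed.

Lemma regulatedB f g : regulated a b f -> regulated a b g ->
  regulated a b (fun x => f x - g x).
Proof.
by move=> [fl fr] [gl gr]; split=> t tab; apply: is_cvgB; auto.
Qed.

Lemma burkillD F1 F2 G1 G2 : burkill a b lam F1 G1 -> burkill a b lam F2 G2 ->
  burkill a b lam (fun u v => F1 u v + F2 u v) (fun x => G1 x + G2 x).
Proof.
move=> [r1 s1 l1 e1] [r2 s2 l2 e2]; split.
- exact: regulatedD.
- move=> s t as_ st tb.
  rewrite (eq_cvg _ _ (fun m => lam_sumD F1 F2 (lam m) s t)).
  apply: (cvg_lim_eq _ (cvgD (s1 _ _ as_ st tb) (s2 _ _ as_ st tb))); lra.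
- move=> t tab; apply: (cvg_lim_eq _ (cvgD (l1 _ tab) (l2 _ tab))).
  have -> := llim_unique (cvgD (llimP r1 tab) (llimP r2 tab)); lra.
- move=> t tab; apply: (cvg_lim_eq _ (cvgD (e1 _ tab) (e2 _ tab))).
  have -> := rlim_unique (cvgD (rlimP r1 tab) (rlimP r2 tab)); lra.
Qed.

Lemma burkill_increment p : regulated a b p ->
  burkill a b lam (fun u v => p v - p u) p.
Proof.
move=> rp; split=> //.
- move=> s t _ _ _.
  rewrite (eq_cvg _ _ (fun m => lam_sum_telescope p (lam m) s t)).
  exact: cvg_cst.
- by move=> t tab; apply: cvgB; [exact: cvg_cst|exact: llimP tab].
- by move=> t tab; apply: cvgB; [exact: rlimP tab|exact: cvg_cst].
Qed.

Lemma near_left_itv t : a < t <= b -> \forall x \near t^'-, a <= x < t.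
Proof.
case/andP=> at_ _; near=> x; apply/andP; split; near: x.
  exact: nbhs_left_ge.
exact: nbhs_left_lt.
Unshelve. all: by end_near. Qed.

Lemma near_right_itv t : a <= t < b -> \forall x \near t^'+, t < x <= b.
Proof.
case/andP=> _ tb; near=> x; apply/andP; split; near: x.
  exact: nbhs_right_gt.
exact: nbhs_right_ltW.
Unshelve. all: by end_near. Qed.

Lemma burkill_eq F1 F2 G : nested_partitions a b lam ->
  (forall u v, a <= u -> u < v -> v <= b -> F1 u v = F2 u v) ->
  burkill a b lam F1 G -> burkill a b lam F2 G.
Proof.
move=> hlam E [rG sG lG eG]; split=> //.
- move=> s t as_ st tb.
  rewrite -(eq_cvg _ _ (f := fun m => lam_sum F1 (lam m) s t)); first exact: sG.
  move=> m; apply: lam_sum_eq => // [|u v su uv vt].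
    exact: (lam_sorted hlam).
  by apply: E => //; [exact: le_trans su|exact: le_trans tb].
- move=> t /[dup] tab /andP[_ tb]; apply: cvg_trans (lG t tab).
  apply: near_eq_cvg; apply: filterS (near_left_itv tab) => x /andP[ax xt].
  exact: E.
- move=> t /[dup] tab /andP[at_ _]; apply: cvg_trans (eG t tab).
  apply: near_eq_cvg; apply: filterS (near_right_itv tab) => x /andP[tx xb].
  exact: E.
Qed.

(** At a point outside the partitions [p] is continuous on the right, so there
the increments of [p] over intervals around the point and over intervals ending
at it have the same limit. *)
Lemma edge_limits_increment p (A : R -> R) : regulated a b p ->
  [set t | a < t < b /\ rjump b p t != 0] `<=` union_partitions a lam ->
  (forall t, a < t <= b -> {for p t - llim p t, continuous A}) ->
  (forall t, a <= t < b -> {for rlim p t - p t, continuous A}) -> A 0 = 0 ->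
  edge_limits a b lam (fun u v => A (p v - p u))
    (fun t => A (p t - llim p t)) (fun t => A (rlim p t - p t)).
Proof.
move=> rp up Al Ar A0; split.
- move=> t tab; apply: continuous_cvg; first exact: Al.
  by apply: cvgB; [exact: cvg_cst|exact: llimP tab].
- move=> t tab; apply: continuous_cvg; first exact: Ar.
  by apply: cvgB; [exact: rlimP tab|exact: cvg_cst].
- move=> t tab Ut; case/andP: (tab) => at_ tb.
  have lt' : a < t <= b by rewrite at_ ltW.
  have rt' : a <= t < b by rewrite tb ltW.
  have r0 : rlim p t = p t.
    apply/eqP; rewrite -subr_eq0 -(rjumpE _ tb).
    by apply/negPn/negP => ne; apply: Ut; apply: up.
  split; first by rewrite r0 subrr A0.
  apply: continuous_cvg; first exact: Al.
  apply: cvgB; last exact: cvg_comp cvg_fst (llimP rp lt').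
  by rewrite -r0; exact: cvg_comp cvg_snd (rlimP rp rt').
Qed.

Lemma edge_limitsB F1 F2 L1 L2 R1 R2 :
  edge_limits a b lam F1 L1 R1 -> edge_limits a b lam F2 L2 R2 ->
  edge_limits a b lam (fun u v => F1 u v - F2 u v)
    (fun t => L1 t - L2 t) (fun t => R1 t - R2 t).
Proof.
move=> [l1 r1 u1] [l2 r2 u2]; split.
- by move=> t tab; apply: cvgB; [exact: l1|exact: l2].
- by move=> t tab; apply: cvgB; [exact: r1|exact: r2].
- move=> t tab Ut; have [-> h1] := u1 t tab Ut; have [-> h2] := u2 t tab Ut.
  by rewrite subrr; split=> //; exact: cvgB.
Qed.

End Algebra.

Section Comparable.
Variables (R : realType) (A : set_system R).
Hypothesis FA : Filter A.

Lemma cvg_increment_small (p : R -> R) (c d : R) : p x @[x --> A] --> c ->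
  0 < d -> exists2 D, A D & forall u v, D u -> D v -> `|p v - p u| <= d.
Proof.
move=> pc d0; have d2 : 0 < d / 2 by rewrite divr_gt0.
exists [set x | `|c - p x| <= d / 2]; first exact: cvgr_dist_le pc _ d2.
by move=> u v /=; rewrite !ler_norml => /andP[? ?] /andP[? ?];
  apply/andP; split; lra.
Qed.

Lemma ln_increment_comparable (f : R -> R) (c : R) : f x @[x --> A] --> c ->
  0 < c ->
  comparable_along A (fun u v => (ln (f v) - ln (f u)) ^+ 2)
    (fun u v => (f v - f u) ^+ 2) (fun u v => (f v - f u) ^+ 2) (c ^- 2).
Proof.
move=> fc c0 e e0.
have f0 : \forall x \near A, 0 < f x by exact: cvgr_gt fc _ c0.
have f2 : (f x ^- 2) @[x --> A] --> c ^- 2.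
  apply: cvgV; first by rewrite expf_neq0 // gt_eqF.
  rewrite expr2; under eq_fun do rewrite expr2; exact: cvgM.
exists [set x | 0 < f x /\ `|f x ^- 2 - c ^- 2| <= e].
  near=> x; split; first by near: x.
  by rewrite distrC; near: x; exact: cvgr_dist_le f2 _ e0.
by move=> u v [u0 u2] [v0 v2] _; exact: ln_diff_sqr.
Unshelve. all: by end_near. Qed.

Lemma expR_increment_comparable (l : R -> R) (c : R) : l x @[x --> A] --> c ->
  comparable_along A (fun u v => expR (l v - l u) - 1 - (l v - l u))
    (fun u v => (l v - l u) ^+ 2) (fun u v => (l v - l u) ^+ 2) 2^-1.
Proof.
move=> lc e e0; have d0 : 0 < Num.min 2^-1 (e / 2).
  by rewrite lt_min divr_gt0 // invr_gt0 ltr0n.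
have [D AD HD] := cvg_increment_small lc d0.
exists D => // u v Du Dv _; have := HD u v Du Dv.
set x := l v - l u; rewrite le_min => /andP[x1 x2].
have := expR_taylor2 x1; rewrite [_ * x ^+ 2]mulrC => /le_trans; apply.
rewrite exprSr mulrA -normrX ger0_norm ?sqr_ge0 //.
have := sqr_ge0 x; nra.
Qed.

Section Monotone.
Variables (l g : R -> R) (c c' : R).
Hypothesis lc : l x @[x --> A] --> c.
Hypothesis gc : g x @[x --> A] --> c'.
Hypothesis mono : exists2 D, A D &
  forall u v, D u -> D v -> u < v -> g u - l u <= g v - l v.

Let w u v := (l v - l u) ^+ 2 + ((g v - l v) - (g u - l u)).

(** Locally [g - l] has small nonnegative increments, so replacing those of [l]
by those of [g] in a quadratic expression costs little. *)
Lemma small_pair d : 0 < d ->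
  exists2 D, A D & forall u v, D u -> D v -> u < v -> exists x y, [/\ x = l v - l u, y = (g v - l v) - (g u - l u), `|x| <= d,
    0 <= y & y <= d].
Proof.
move=> d0; case: mono => D3 AD3 m3.
have [D1 AD1 H1] := cvg_increment_small lc d0.
have [D2 AD2 H2] := cvg_increment_small (cvgB gc lc) d0.
exists (D1 `&` D2 `&` D3); first by apply: filterI => //; exact: filterI.
move=> u v [[u1 u2] u3] [[v1 v2] v3] uv.
exists (l v - l u), ((g v - l v) - (g u - l u)); split=> //.
- exact: H1.
- by rewrite subr_ge0; exact: m3.
- by apply: le_trans (ler_norm _) (H2 _ _ u2 v2).
Qed.

Lemma sqr_increment_comparable :
  comparable_along A (fun u v => (g v - g u) ^+ 2)
    (fun u v => (l v - l u) ^+ 2) w 1.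
Proof.
move=> e e0; have e3 : 0 < e / 3 by rewrite divr_gt0.
have [D AD HD] := small_pair e3.
exists D => // u v Du Dv uv.
have [x [y [Ex Ey]]] := HD u v Du Dv uv.
have -> : g v - g u = x + y by lra.
rewrite /w -Ex -Ey ler_norml => /andP[? ?] ? ?.
have -> : (x + y) ^+ 2 - 1 * x ^+ 2 = y * (2 * x + y) by ring.
have := sqr_ge0 x.
by rewrite ler_norml => ?; apply/andP; split; nra.
Qed.

Lemma log_defect_comparable (q : R -> R -> R) :
  comparable_along A
    (fun u v => log_defect (g v - g u) - (expR (l v - l u) - 1 - (l v - l u)))
    q w 0.
Proof.
move=> e e0; have d0 : 0 < Num.min 4^-1 (e / 20).
  by rewrite lt_min divr_gt0 // invr_gt0 ltr0n.
have [D AD HD] := small_pair d0.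
exists D => // u v Du Dv uv.
(* With [x] and [y] the increments of [l] and [g - l], both terms are within
[O (d * (x^2 + y))] of [x^2 / 2]. *)
have [x [y [Ex Ey]]] := HD u v Du Dv uv.
have -> : g v - g u = x + y by lra.
rewrite /w -Ex -Ey mul0r subr0; set d := Num.min _ _.
have d4 : d <= 4^-1 by rewrite /d ge_min lexx.
have de : d <= e / 20 by rewrite /d ge_min lexx orbT.
move=> xd y0 yd.
have x2 : `|x| <= 2^-1 by lra.
have xy2 : `|x + y| <= 2 * d.
  by apply: (le_trans (ler_normD _ _)); rewrite [`|y|]ger0_norm //; lra.
have H1 := expR_taylor2 x2.
have H2 : `|log_defect (x + y) - (x + y) ^+ 2 / 2| <= 2 * `|x + y| ^+ 3.
  by apply: log_defect_taylor2; lra.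
have cube (z k : R) : `|z| <= k -> 2 * `|z| ^+ 3 <= 2 * k * z ^+ 2.
  move=> zk; rewrite exprS -normrX [`|z ^+ 2|]ger0_norm ?sqr_ge0 //.
  by have := sqr_ge0 z; nra.
have {}H1 := le_trans H1 (cube _ _ xd).
have {}H2 := le_trans H2 (cube _ _ xy2).
move: xd H1 H2; rewrite !ler_norml => /andP[? ?] /andP[? ?] /andP[? ?].
have := sqr_ge0 x => sx.
have K1 : (x + y) ^+ 2 <= 2 * x ^+ 2 + y by have := sqr_ge0 (x - y); nra.
have K2 : 2 * (2 * d) * (x + y) ^+ 2 <= 4 * d * (2 * x ^+ 2 + y) by nra.
have K3 : d * x ^+ 2 <= e / 20 * x ^+ 2 by nra.
have K4 : d * y <= e / 20 * y by nra.
have K5 : `|(x + y) ^+ 2 - x ^+ 2| <= 3 * d * y.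
  have -> : (x + y) ^+ 2 - x ^+ 2 = y * (2 * x + y) by ring.
  by rewrite ler_norml; apply/andP; split; nra.
move: K5; rewrite ler_norml => /andP[? ?].
by apply/andP; split; lra.
Qed.

End Monotone.

End Comparable.

(** * The classical notions as integrals of interval functions *)

Section Conversions.
Variables (R : realType) (a b : R) (lam : nat -> seq R).
Hypothesis ab : a < b.
Hypothesis hlam : nested_partitions a b lam.
Implicit Types (F : R -> R -> R) (f g p G : R -> R) (s t : R).

Lemma regulated_bounded f : regulated a b f ->
  exists M : R, forall t, a <= t <= b -> f t <= M.
Proof.
move=> rf; pose P s t := exists M : R, forall x, s <= x <= t -> f x <= M.
apply: (@interval_induction _ a b P) => // [s t r _ st tr _ [M1 H1] [M2 H2]||].
- exists (Num.max M1 M2) => x /andP[sx xr]; rewrite le_max.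
  have [xt|/ltW tx] := lerP x t; first by rewrite H1 // sx.
  by rewrite H2 ?orbT // tx.
- move=> t at_ tb; have tab : a < t <= b by rewrite at_ tb.
  have H0 : \forall x \near t^'-, f x < llim f t + 1.
    by apply: (cvgr_lt _ (llimP rf tab)); rewrite ltrDl.
  have := near_left_seg H0; apply: filterS => s H as_.
  exists (Num.max (llim f t + 1) (f t)) => x /andP[sx]; rewrite le_max le_eqVlt.
  by move=> /orP[/eqP -> |xt]; rewrite ?lexx ?orbT // ltW // H // sx.
- move=> t at_ tb; have tab : a <= t < b by rewrite at_ tb.
  have H0 : \forall x \near t^'+, f x < rlim f t + 1.
    by apply: (cvgr_lt _ (rlimP rf tab)); rewrite ltrDl.
  have := near_right_seg H0; apply: filterS => s H as_.
  exists (Num.max (rlim f t + 1) (f t)) => x /andP[+ xs]; rewrite le_max le_eqVlt.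
  by move=> /orP[/eqP <- |tx]; rewrite ?lexx ?orbT // ltW // H // tx.
Qed.

Lemma burkill_shift F G c : burkill a b lam F G ->
  burkill a b lam F (fun x => G x - c).
Proof.
move=> bG; have rc : regulated a b (cst (- c) : R -> R).
  by split=> t _; exact: is_cvg_cst.
have := burkillD bG (burkill_increment lam rc).
apply: burkill_eq => // u v _ _ _.
by rewrite /cst subrr addr0.
Qed.

Lemma burkill_ljump F G t (L : R) : burkill a b lam F G -> a < t <= b ->
  F x t @[x --> t^'-] --> L -> G t - llim G t = L.
Proof. by move=> [_ _ /(_ t) + _] tab; move=> /(_ tab); exact: cvg_unique. Qed.

Lemma burkill_rjump F G t (L : R) : burkill a b lam F G -> a <= t < b ->
  F t x @[x --> t^'+] --> L -> rlim G t - G t = L.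
Proof. by move=> [_ _ _ /(_ t)] + tab; move=> /(_ tab); exact: cvg_unique. Qed.

Lemma quadratic_variation_burkill g W : regulated a b g ->
  is_quadratic_variation a b lam g W <->
  burkill a b lam (fun u v => (g v - g u) ^+ 2) W /\ W a = 0.
Proof.
move=> rg.
have El t : a < t <= b ->
    (g t - g x) ^+ 2 @[x --> t^'-] --> (g t - llim g t) ^+ 2.
  move=> tab; have H : g t - g x @[x --> t^'-] --> g t - llim g t.
    by apply: cvgB; [exact: cvg_cst|exact: llimP tab].
  by rewrite expr2; under eq_fun do rewrite expr2; exact: cvgM.
have Er t : a <= t < b ->
    (g x - g t) ^+ 2 @[x --> t^'+] --> (rlim g t - g t) ^+ 2.
  move=> tab; have H : g x - g t @[x --> t^'+] --> rlim g t - g t.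
    by apply: cvgB; [exact: rlimP tab|exact: cvg_cst].
  by rewrite expr2; under eq_fun do rewrite expr2; exact: cvgM.
split=> [[rW W0 sW lW eW]|[bW W0]].
- split=> //; split=> //.
  + move=> s t as_ st tb; have := sW s t as_ st tb.
    by under eq_cvg do rewrite (lam_sumE (fun u v => (g v - g u) ^+ 2)).
  + move=> t tab; case/andP: (tab) => at_ _.
    by rewrite -(ljumpE _ at_) lW // ljumpE //; exact: El.
  + move=> t tab; case/andP: (tab) => _ tb.
    by rewrite -(rjumpE _ tb) eW // rjumpE //; exact: Er.
- case: (bW) => rW sW _ _; split=> //.
  + move=> s t as_ st tb; have := sW s t as_ st tb.
    by under [X in _ -> X]eq_cvg do rewrite (lam_sumE (fun u v => (g v - g u) ^+ 2)).
  + move=> t tab; case/andP: (tab) => at_ _; rewrite !ljumpE //.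
    exact: (burkill_ljump bW tab (El t tab)).
  + move=> t tab; case/andP: (tab) => _ tb; rewrite !rjumpE //.
    exact: (burkill_rjump bW tab (Er t tab)).
Qed.

Section PositiveIntegrand.
Variables (f : R -> R) (C : R).
Hypothesis rf : regulated a b f.
Hypothesis C0 : 0 < C.
Hypothesis fC : forall t, a <= t <= b -> C <= f t.

Lemma pos_fun t : a <= t <= b -> 0 < f t.
Proof. by move=> /fC; exact: lt_le_trans. Qed.

Lemma llim_ge t : a < t <= b -> C <= llim f t.
Proof.
move=> tab; move/cvgr_to_ge: (llimP rf tab); apply.
apply: filterS (near_left_itv tab) => x /andP[ax /ltW xt].
by apply: fC; rewrite ax (le_trans xt) //; case/andP: tab.
Qed.

Lemma rlim_ge t : a <= t < b -> C <= rlim f t.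
Proof.
move=> tab; move/cvgr_to_ge: (rlimP rf tab); apply.
apply: filterS (near_right_itv tab) => x /andP[/ltW tx xb].
by apply: fC; rewrite xb andbT (le_trans _ tx) //; case/andP: tab.
Qed.

Lemma llim_gt0 t : a < t <= b -> 0 < llim f t.
Proof. by move=> /llim_ge; exact: lt_le_trans. Qed.

Lemma rlim_gt0 t : a <= t < b -> 0 < rlim f t.
Proof. by move=> /rlim_ge; exact: lt_le_trans. Qed.

Lemma ratio_cvg_left t : a < t <= b ->
  f t / f x - 1 @[x --> t^'-] --> f t / llim f t - 1.
Proof.
move=> tab; apply: cvgB; last exact: cvg_cst.
apply: cvgM; first exact: cvg_cst.
by apply: cvgV; [rewrite gt_eqF // llim_gt0|exact: llimP tab].
Qed.

Lemma ratio_cvg_right t : a <= t < b ->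
  f x / f t - 1 @[x --> t^'+] --> rlim f t / f t - 1.
Proof.
move=> tab; apply: cvgB; last exact: cvg_cst.
by apply: cvgM; [exact: rlimP tab|exact: cvg_cst].
Qed.

Lemma llim_inv t : a < t <= b -> llim (fun x => (f x)^-1) t = (llim f t)^-1.
Proof.
move=> tab; apply: llim_unique; apply: cvgV; last exact: llimP tab.
by rewrite gt_eqF // llim_gt0.
Qed.

Lemma LC_integral_burkill G :
  is_LC_integral a b lam (fun x => (f x)^-1) f G <->
  burkill a b lam (fun u v => f v / f u - 1) G /\ G a = 0.
Proof.
have Fe u v : a <= u -> u < v -> v <= b ->
    (f u)^-1 * (f v - f u) = f v / f u - 1.
  move=> au uv vb; have : 0 < f u by rewrite pos_fun // au (le_trans (ltW uv)).
  by move=> fu; field; rewrite gt_eqF.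
have Se m s t : a <= s -> s < t -> t <= b ->
    lam_sum (fun u v => (f u)^-1 * (f v - f u)) (lam m) s t =
    lam_sum (fun u v => f v / f u - 1) (lam m) s t.
  move=> as_ st tb; apply: lam_sum_eq => // [|u v su uv vt].
    exact: (lam_sorted hlam).
  by apply: Fe => //; [exact: le_trans su|exact: le_trans tb].
split=> [[rG G0 sG lG eG]|[bG G0]].
- split=> //; split=> //.
  + move=> s t as_ st tb; have := sG s t as_ st tb.
    by under eq_cvg do rewrite (lam_sumE (fun u v => (f u)^-1 * (f v - f u))) Se //.
  + move=> t tab; case/andP: (tab) => at_ _.
    rewrite -(ljumpE _ at_) lG // ljumpE // llim_inv //.
    apply: (cvg_lim_eq _ (ratio_cvg_left tab)).
    by have := llim_gt0 tab => l0; field; rewrite gt_eqF.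
  + move=> t tab; case/andP: (tab) => at_ tb.
    rewrite -(rjumpE _ tb) eG // rjumpE //.
    apply: (cvg_lim_eq _ (ratio_cvg_right tab)).
    have f0 : 0 < f t by rewrite pos_fun // at_ ltW.
    by field; rewrite gt_eqF.
- case: (bG) => rG sG _ _; split=> //.
  + move=> s t as_ st tb; have := sG s t as_ st tb.
    by under [X in _ -> X]eq_cvg do
      rewrite (lam_sumE (fun u v => (f u)^-1 * (f v - f u))) Se //.
  + move=> t tab; case/andP: (tab) => at_ _; rewrite !ljumpE //.
    rewrite (burkill_ljump bG tab (ratio_cvg_left tab)) llim_inv //.
    by have := llim_gt0 tab => l0; field; rewrite gt_eqF.
  + move=> t tab; case/andP: (tab) => at_ tb; rewrite !rjumpE //.
    rewrite (burkill_rjump bG tab (ratio_cvg_right tab)).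
    have f0 : 0 < f t by rewrite pos_fun // at_ ltW.
    by field; rewrite gt_eqF.
Qed.

Lemma regulated_inv : regulated a b (fun x => (f x)^-1).
Proof.
split=> t tab; apply/cvg_ex.
  exists (llim f t)^-1; apply: cvgV; last exact: llimP tab.
  by rewrite gt_eqF // llim_gt0.
exists (rlim f t)^-1; apply: cvgV; last exact: rlimP tab.
by rewrite gt_eqF // rlim_gt0.
Qed.

Lemma ln_cvg_left t : a < t <= b -> ln (f x) @[x --> t^'-] --> ln (llim f t).
Proof.
move=> tab; apply: continuous_cvg; last exact: llimP tab.
exact/continuous_ln/llim_gt0.
Qed.

Lemma ln_cvg_right t : a <= t < b -> ln (f x) @[x --> t^'+] --> ln (rlim f t).
Proof.
move=> tab; apply: continuous_cvg; last exact: rlimP tab.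
exact/continuous_ln/rlim_gt0.
Qed.

Lemma regulated_ln : regulated a b (fun x => ln (f x)).
Proof.
split=> t tab; apply/cvg_ex.
  by exists (ln (llim f t)); exact: ln_cvg_left.
by exists (ln (rlim f t)); exact: ln_cvg_right.
Qed.

End PositiveIntegrand.
End Conversions.

(** * Products as exponentials, and the logarithm of the path *)

Section ProductsAsExponentials.
Variables (R : realType) (a b : R) (lam : nat -> seq R) (g : R -> R).
Hypothesis hlam : nested_partitions a b lam.
Hypothesis rg : regulated a b g.
Hypothesis ug :
  [set t | a < t < b /\ rjump b g t != 0] `<=` union_partitions a lam.
Hypothesis gl : forall t, a < t <= b -> 0 < 1 + (g t - llim g t).
Hypothesis gr : forall t, a <= t < b -> 0 < 1 + (rlim g t - g t).

(** The logarithm of a nonpositive factor is meaningless, so the identity between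
products and exponentials of sums of logarithms fails unless all factors are
positive; [bad] counts the factors that are not. *)
Let bad (r : R) : R := if 1 + r <= 0 then 1 else 0.

Let bad_continuous r : 0 < 1 + r -> {for r, continuous bad}.
Proof.
move=> r0; have H : \forall x \near r, bad x = 0.
  have : \forall x \near r, - 1 < x by apply: lt_nbhsr; lra.
  by apply: filterS => x x1; rewrite /bad leNgt (_ : 0 < 1 + x) //; lra.
rewrite /prop_for /continuous_at (nbhs_singleton H).
exact: cvg_near_cst.
Qed.

Let bad0 : bad 0 = 0.
Proof. by rewrite /bad addr0 ler10. Qed.

Let burkill0 : burkill a b lam (fun _ _ => 0) (fun _ => 0).
Proof.
have r0 : regulated a b (fun _ : R => 0 : R) by split=> t _; exact: is_cvg_cst.
apply: burkill_eq (burkill_increment lam r0) => // u v _ _ _; exact: subrr.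
Qed.

Lemma pairmap_pos (p : seq R) x :
  path_sum (fun u v => bad (g v - g u)) x p < 1 ->
  all (fun z => 0 < z) (pairmap (fun u v => 1 + (g v - g u)) x p).
Proof.
have N0 y q : 0 <= path_sum (fun u v => bad (g v - g u)) y q.
  elim: q y => [|z q IH] y; first by rewrite path_sum_nil.
  by rewrite path_sum_cons addr_ge0 // /bad; case: ifP.
elim: p x => // y p IH x; rewrite path_sum_cons /= => H.
have := N0 y p; move: H; rewrite {1}/bad.
case: (lerP (1 + (g y - g x)) 0) => [_ /= h1 h2|_ /=]; first by exfalso; lra.
by rewrite add0r => + _; exact: IH.
Qed.

(** Over a short interval the increment of [g] is small or close to a jump, and
jumps exceed -1, so locally no factor is bad. The number of bad factors is
itself a sum over the partition, which therefore tends to 0. *)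
Lemma eventually_pos s t : a <= s -> s < t -> t <= b ->
  \forall m \near \oo, all (fun z => 0 < z)
    (pairmap (fun u v => 1 + (g v - g u)) s (rcons (inner (lam m) s t) t)).
Proof.
move=> as_ st tb.
suff H : lam_sum (fun u v => bad (g v - g u)) (lam m) s t @[m --> \oo] --> (0 : R).
  have H1 : \forall m \near \oo,
      lam_sum (fun u v => bad (g v - g u)) (lam m) s t < 1.
    exact: (cvgr_lt _ H).
  by apply: filterS H1 => m; exact: pairmap_pos.
have loc A (c : R) : Filter A -> g x @[x --> A] --> c ->
    comparable_along A (fun u v => bad (g v - g u)) (fun _ _ => 0) (fun _ _ => 0) 0.
  move=> FA gA e e0; have h0 : (0 : R) < 2^-1 by lra.
  have [D AD HD] := cvg_increment_small FA gA h0.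
  exists D => // u v Du Dv _; have := HD u v Du Dv.
  rewrite ler_norml => /andP[? _].
  have -> : bad (g v - g u) = 0 by rewrite /bad leNgt (_ : 0 < 1 + _) //; lra.
  by rewrite !mulr0 subr0 normr0.
apply: (@burkill_negligible _ a b lam hlam _ (fun _ _ => 0) (fun _ _ => 0)
  (fun _ => 0) (fun _ => 0) (fun t => bad (g t - llim g t))
  (fun t => bad (rlim g t - g t)) (fun _ => 0) (fun _ => 0)) => //.
- by apply: edge_limits_increment => //; [move=> x /gl|move=> x /gr];
    exact: bad_continuous.
- by move=> x xab; apply: loc; exact: llimP xab.
- by move=> x xab; apply: loc; exact: rlimP xab.
- by move=> x /gl; rewrite /bad ltNge => /negbTE ->.
- by move=> x /gr; rewrite /bad ltNge => /negbTE ->.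
Qed.

Lemma prod_pairmap_expR (p : seq R) x :
  all (fun z => 0 < z) (pairmap (fun u v => 1 + (g v - g u)) x p) ->
  \prod_(z <- pairmap (fun u v => 1 + g v - g u) x p) z =
  expR (path_sum (fun u v => ln (1 + (g v - g u))) x p).
Proof.
elim: p x => [|y p IH] x; first by rewrite big_nil path_sum_nil expR0.
rewrite path_sum_cons /= big_cons => /andP[xy /IH ->].
by rewrite expRD lnK ?posrE // addrA.
Qed.

Lemma path_log_defect_ge0 (p : seq R) x :
  all (fun z => 0 < z) (pairmap (fun u v => 1 + (g v - g u)) x p) ->
  0 <= path_sum (fun u v => log_defect (g v - g u)) x p.
Proof.
elim: p x => [|y p IH] x; first by rewrite path_sum_nil.
rewrite path_sum_cons /= => /andP[xy /IH H].
by rewrite addr_ge0 // log_defect_ge0.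
Qed.

Lemma prod_eventually_expR s t : a <= s -> s < t -> t <= b ->
  \forall m \near \oo,
    \prod_(1 <= i < size (restr (lam m) s t))
      (1 + g (restr (lam m) s t)`_i - g (restr (lam m) s t)`_i.-1) =
    expR (g t - g s - lam_sum (fun u v => log_defect (g v - g u)) (lam m) s t).
Proof.
move=> as_ st tb; apply: filterS (eventually_pos as_ st tb) => m pos.
rewrite restrE (big_pairE _ (fun u v => 1 + g v - g u)) prod_pairmap_expR //.
congr expR; rewrite -(lam_sum_telescope g (lam m)) -[X in _ - X]mul1r -mulNr.
rewrite -lam_sumZ -lam_sumD; congr (path_sum _ _ _).
by apply/funext => u; apply/funext => v; rewrite /log_defect; lra.
Qed.

Lemma log_defect_sum_ge0 s t (L : R) : a <= s -> s < t -> t <= b ->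
  lam_sum (fun u v => log_defect (g v - g u)) (lam m) s t @[m --> \oo] --> L ->
  0 <= L.
Proof.
move=> as_ st tb /cvgr_to_ge; apply.
by apply: filterS (eventually_pos as_ st tb) => m; exact: path_log_defect_ge0.
Qed.

End ProductsAsExponentials.

Section Logarithm.
Variables (R : realType) (a b : R) (lam : nat -> seq R) (f : R -> R) (C : R).
Hypothesis hlam : nested_partitions a b lam.
Hypothesis rf : regulated a b f.
Hypothesis C0 : 0 < C.
Hypothesis fC : forall t, a <= t <= b -> C <= f t.
Hypothesis uf :
  [set t | a < t < b /\ rjump b f t != 0] `<=` union_partitions a lam.
Variable V : R -> R.
Hypothesis qV : burkill a b lam (fun u v => (f v - f u) ^+ 2) V.

Let l x := ln (f x).
Let rl : regulated a b l := regulated_ln rf C0 fC.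

Lemma llim_ln t : a < t <= b -> llim l t = ln (llim f t).
Proof. by move=> tab; apply: llim_unique; exact: (ln_cvg_left rf C0 fC tab). Qed.

Lemma rlim_ln t : a <= t < b -> rlim l t = ln (rlim f t).
Proof. by move=> tab; apply: rlim_unique; exact: (ln_cvg_right rf C0 fC tab). Qed.

Lemma expR_ljump_ln t : a < t <= b -> expR (l t - llim l t) = f t / llim f t.
Proof.
move=> tab; rewrite expRB llim_ln // !lnK ?posrE ?(llim_gt0 rf C0 fC) //.
by apply: (pos_fun C0 fC); case/andP: tab => /ltW -> ->.
Qed.

Lemma expR_rjump_ln t : a <= t < b -> expR (rlim l t - l t) = rlim f t / f t.
Proof.
move=> tab; rewrite expRB rlim_ln // !lnK ?posrE ?(rlim_gt0 rf C0 fC) //.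
by apply: (pos_fun C0 fC); case/andP: tab => -> /ltW ->.
Qed.

Lemma expR_increment_ln u v : a <= u -> u < v -> v <= b ->
  expR (l v - l u) = f v / f u.
Proof.
move=> au uv vb; rewrite expRB !lnK // posrE; apply: (pos_fun C0 fC).
  by rewrite au (le_trans (ltW uv)).
by rewrite vb (le_trans au) // ltW.
Qed.

Lemma rjump_ln_union :
  [set t | a < t < b /\ rjump b l t != 0] `<=` union_partitions a lam.
Proof.
move=> t [tab]; case/andP: (tab) => at_ tb rj; apply: uf; split=> //.
apply: contra rj; rewrite !rjumpE // subr_eq0 => /eqP E.
by rewrite rlim_ln ?tb ?ltW // E /l subrr.
Qed.

Lemma sqr_ln_burkill :
  exists W, burkill a b lam (fun u v => (l v - l u) ^+ 2) W.
Proof.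
have ctn x : {for x, continuous (fun r : R => r ^+ 2)} by exact: exprn_continuous.
have E := @edge_limits_increment _ _ _ lam _ (fun r => r ^+ 2) rl rjump_ln_union
  (fun t _ => ctn _) (fun t _ => ctn _) (expr0n _ _).
apply: (burkill_exists hlam qV qV _ E (kl := fun t => llim f t ^- 2)
  (kr := fun t => rlim f t ^- 2)) => [u v _ _ _|t tab|t tab].
- exact: sqr_ge0.
- by apply: ln_increment_comparable; [exact: llimP tab|exact: (llim_gt0 rf C0 fC tab)].
- by apply: ln_increment_comparable; [exact: rlimP tab|exact: (rlim_gt0 rf C0 fC tab)].
Qed.

Let e2 (r : R) := expR r - 1 - r.

Let e2_continuous x : {for x, continuous e2}.
Proof.
apply: cvgB; last exact: cvg_id.
by apply: cvgB; [exact: continuous_expR|exact: cvg_cst].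
Qed.

Let e20 : e2 0 = 0. Proof. by rewrite /e2 expR0; lra. Qed.

Let e2_edge := @edge_limits_increment _ _ _ lam _ e2 rl rjump_ln_union
  (fun t _ => @e2_continuous _) (fun t _ => @e2_continuous _) e20.

(** The increments of [f] relative to [f] differ from those of [ln f] by a
quantity of second order, whose sums converge because [ln f] has a quadratic
variation. *)
Lemma ratio_burkill : exists G, burkill a b lam (fun u v => f v / f u - 1) G.
Proof.
have [W qW] := sqr_ln_burkill.
have [] := burkill_exists hlam qW qW _ e2_edge (kl := fun _ => 2^-1)
  (kr := fun _ => 2^-1).
- by move=> u v _ _ _; exact: sqr_ge0.
- by move=> t tab; apply: expR_increment_comparable; exact: llimP tab.
- by move=> t tab; apply: expR_increment_comparable; exact: rlimP tab.
move=> P qP; exists (fun x => P x + l x).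
apply: burkill_eq (burkillD qP (burkill_increment lam rl)) => // u v au uv vb.
by rewrite -(expR_increment_ln au uv vb) /e2; lra.
Qed.

Section Additive.
Variable g : R -> R.
Hypothesis rg : regulated a b g.
Hypothesis mono : forall u v, a <= u -> u < v -> v <= b ->
  g u - l u <= g v - l v.

Let w u v := (l v - l u) ^+ 2 + ((g v - l v) - (g u - l u)).

Let w0 u v : a <= u -> u < v -> v <= b -> 0 <= w u v.
Proof. by move=> au uv vb; rewrite addr_ge0 ?sqr_ge0 // subr_ge0 mono. Qed.

Let mono_left t : a < t <= b -> exists2 D, (t^'-) D &
  forall u v, D u -> D v -> u < v -> g u - l u <= g v - l v.
Proof.
move=> tab; exists [set x | a <= x < t]; first exact: near_left_itv tab.
move=> u v /andP[au _] /andP[_ vt] uv; apply: mono => //.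
by rewrite (le_trans (ltW vt)) //; case/andP: tab.
Qed.

Let mono_right t : a <= t < b -> exists2 D, (t^'+) D &
  forall u v, D u -> D v -> u < v -> g u - l u <= g v - l v.
Proof.
move=> tab; exists [set x | t < x <= b]; first exact: near_right_itv tab.
move=> u v /andP[tu _] /andP[_ vb] uv; apply: mono => //.
by rewrite (le_trans _ (ltW tu)) //; case/andP: tab.
Qed.

Hypothesis ug :
  [set t | a < t < b /\ rjump b g t != 0] `<=` union_partitions a lam.

Lemma sqr_burkill : exists W, burkill a b lam (fun u v => (g v - g u) ^+ 2) W.
Proof.
have [W qW] := sqr_ln_burkill.
have ctn x : {for x, continuous (fun r : R => r ^+ 2)} by exact: exprn_continuous.
have E := @edge_limits_increment _ _ _ lam _ (fun r => r ^+ 2) rg ug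
  (fun t _ => ctn _) (fun t _ => ctn _) (expr0n _ _).
have qw := burkillD qW (burkill_increment lam (regulatedB rg rl)).
apply: (burkill_exists hlam qW qw w0 E (kl := fun _ => 1) (kr := fun _ => 1)).
- move=> t tab; apply: (sqr_increment_comparable _ _ _ (mono_left tab)).
    exact: llimP tab.
  exact: llimP tab.
- move=> t tab; apply: (sqr_increment_comparable _ _ _ (mono_right tab)).
    exact: rlimP tab.
  exact: rlimP tab.
Qed.

Hypothesis gl : forall t, a < t <= b -> 1 + (g t - llim g t) = f t / llim f t.
Hypothesis gr : forall t, a <= t < b -> 1 + (rlim g t - g t) = rlim f t / f t.

Lemma ljump_gt t : a < t <= b -> 0 < 1 + (g t - llim g t).
Proof. by move=> tab; rewrite gl // -expR_ljump_ln // expR_gt0. Qed.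

Lemma rjump_gt t : a <= t < b -> 0 < 1 + (rlim g t - g t).
Proof. by move=> tab; rewrite gr // -expR_rjump_ln // expR_gt0. Qed.

Let log_defect_continuous r : 0 < 1 + r -> {for r, continuous (@log_defect R)}.
Proof.
move=> r0; apply: cvgB; first exact: cvg_id.
apply: continuous_cvg; first exact: continuous_ln.
by apply: cvgD; [exact: cvg_cst|exact: cvg_id].
Qed.

(** Both expressions are half the square of an increment to second order; the
jumps of [g] are such that they agree exactly at the edges. *)
Lemma log_defect_vs_ratio s t : a <= s -> s < t -> t <= b ->
  lam_sum (fun u v => log_defect (g v - g u) - (f v / f u - 1 - (l v - l u)))
    (lam m) s t @[m --> \oo] --> (0 : R).
Proof.
move=> as_ st tb; have [W qW] := sqr_ln_burkill.
have qw := burkillD qW (burkill_increment lam (regulatedB rg rl)).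
have E1 := @edge_limits_increment _ _ _ lam _ (@log_defect R) rg ug
  (fun t tab => log_defect_continuous (ljump_gt tab))
  (fun t tab => log_defect_continuous (rjump_gt tab)) (log_defect0 R).
have := @burkill_negligible _ _ _ _ hlam _ _ _ _ _ _ _ (fun _ => 0) (fun _ => 0)
  qW qw w0 (edge_limitsB E1 e2_edge) _ _ s t _ _ as_ st tb.
set X := lam_sum _; move=> H.
rewrite -(eq_cvg _ _ (f := fun m => X (lam m) s t)).
  apply: H => x xab.
  + apply: (log_defect_comparable _ _ _ (mono_left xab)).
      exact: llimP xab.
    exact: llimP xab.
  + apply: (log_defect_comparable _ _ _ (mono_right xab)).
      exact: rlimP xab.
    exact: rlimP xab.
  + have -> : g x - llim g x = expR (l x - llim l x) - 1.
      by rewrite expR_ljump_ln // -gl //; lra.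
    by rewrite log_defect_expR subrr.
  + have -> : rlim g x - g x = expR (rlim l x - l x) - 1.
      by rewrite expR_rjump_ln // -gr //; lra.
    by rewrite log_defect_expR subrr.
move=> m; apply: lam_sum_eq => // [|u v su uv vt]; first exact: (lam_sorted hlam).
by rewrite -(expR_increment_ln _ uv) //; [exact: le_trans su|exact: le_trans tb].
Qed.

End Additive.
End Logarithm.

(** * The integral of 1/f against f and its product integral *)

Section RatioIntegral.
Variables (R : realType) (a b : R) (lam : nat -> seq R) (f : R -> R) (C : R).
Hypothesis ab : a < b.
Hypothesis hlam : nested_partitions a b lam.
Hypothesis rf : regulated a b f.
Hypothesis C0 : 0 < C.
Hypothesis fC : forall t, a <= t <= b -> C <= f t.
Hypothesis uf :
  [set t | a < t < b /\ rjump b f t != 0] `<=` union_partitions a lam.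
Variable V : R -> R.
Hypothesis qV : burkill a b lam (fun u v => (f v - f u) ^+ 2) V.

Let l x := ln (f x).
Let rl : regulated a b l := regulated_ln rf C0 fC.

Variable G : R -> R.
Hypothesis bG : burkill a b lam (fun u v => f v / f u - 1) G.

Let rG : regulated a b G. Proof. by case: bG. Qed.

Lemma ratio_defect_cvg s t : a <= s -> s < t -> t <= b ->
  lam_sum (fun u v => f v / f u - 1 - (l v - l u)) (lam m) s t @[m --> \oo] -->
  (G t - l t) - (G s - l s).
Proof.
move=> as_ st tb; case: bG => _ /(_ s t as_ st tb) sG _ _.
have E m : lam_sum (fun u v => f v / f u - 1 - (l v - l u)) (lam m) s t =
    lam_sum (fun u v => f v / f u - 1) (lam m) s t - (l t - l s).
  rewrite -(lam_sum_telescope l (lam m)) -[- lam_sum _ _ _ _]mulN1r -lam_sumZ -lam_sumD.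
  congr (lam_sum _ _ _ _); apply/funext => u; apply/funext => v.
  by rewrite mulN1r.
rewrite (eq_cvg _ _ E).
by apply: (cvg_lim_eq _ (cvgB sG (cvg_cst (l t - l s)))); lra.
Qed.

Lemma ratio_minus_ln_le u v : a <= u -> u < v -> v <= b ->
  G u - l u <= G v - l v.
Proof.
move=> au uv vb; rewrite -subr_ge0.
move/cvgr_to_ge: (ratio_defect_cvg au uv vb); apply; near=> m.
apply: lam_sum_ge0 => // [|x y ux xy yv]; first exact: (lam_sorted hlam).
rewrite -(expR_increment_ln C0 fC _ xy) ?(le_trans au ux) ?(le_trans yv vb) //.
by have := expR_ge1Dx (l y - l x); rewrite /l; lra.
Unshelve. all: by end_near. Qed.

Lemma ratio_ljump t : a < t <= b -> 1 + (G t - llim G t) = f t / llim f t.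
Proof.
by move=> tab; rewrite (burkill_ljump bG tab (ratio_cvg_left rf C0 fC tab)) subrKC.
Qed.

Lemma ratio_rjump t : a <= t < b -> 1 + (rlim G t - G t) = rlim f t / f t.
Proof.
by move=> tab; rewrite (burkill_rjump bG tab (ratio_cvg_right rf tab)) subrKC.
Qed.

Lemma ratio_rjump_union :
  [set t | a < t < b /\ rjump b G t != 0] `<=` union_partitions a lam.
Proof.
move=> t [tab]; case/andP: (tab) => at_ tb rj; apply: uf; split=> //.
have tab' : a <= t < b by rewrite tb ltW.
have f0 : 0 < f t by rewrite (pos_fun C0 fC) // !ltW.
apply: contra rj; rewrite !rjumpE // subr_eq0 => /eqP E.
have H := ratio_rjump tab'; rewrite E divff ?gt_eqF // in H.
by apply/eqP; lra.
Qed.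

Lemma ratio_quadratic : Qclass a b lam G.
Proof.
split=> //; have [W qW] := sqr_burkill hlam rf C0 fC uf qV rG
  ratio_minus_ln_le ratio_rjump_union.
exists (fun x => W x - W a); apply/quadratic_variation_burkill => //.
by split; [exact: burkill_shift|rewrite subrr].
Qed.

Lemma ratio_jumps_bounded_below : bounded_below_pos a b
  (fun t => 1 + Num.min (ljump a G t) (rjump b G t)).
Proof.
have [M HM] := regulated_bounded ab rf.
have CM : C <= M by apply: (le_trans (fC _) (HM a _)); rewrite lexx ltW.
have M0 : 0 < M := lt_le_trans C0 CM.
have c1 : C / M <= 1 by rewrite ler_pdivrMr // mul1r.
have ratio x y : C <= x -> 0 < y -> y <= M -> C / M <= x / y.
  move=> Cx y0 yM; rewrite ler_pdivrMr // mulrAC ler_pdivlMr //.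
  by apply: ler_pM => //; exact: ltW.
exists (C / M); first exact: divr_gt0.
move=> t /andP[at_ tb]; rewrite -lerBlDl le_min; apply/andP; split.
- rewrite /ljump; case: ifP => [at'|_]; last by lra.
  have tab : a < t <= b by rewrite at' tb.
  rewrite lerBlDl ratio_ljump //; apply: ratio.
  + by apply: fC; rewrite at_.
  + exact: (llim_gt0 rf C0 fC).
  + move/cvgr_to_le: (llimP rf tab); apply.
    apply: filterS (near_left_itv tab) => x /andP[ax xt].
    by apply: HM; rewrite ax (le_trans (ltW xt)).
- rewrite /rjump; case: ifP => [tb'|_]; last by lra.
  have tab : a <= t < b by rewrite at_ tb'.
  rewrite lerBlDl ratio_rjump //; apply: ratio.
  + exact: (rlim_ge rf fC).
  + by apply: (pos_fun C0 fC); rewrite at_.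
  + by apply: HM; rewrite at_.
Qed.

Lemma ratio_Eclass : G a = 0 -> Eclass a b lam G.
Proof.
move=> Ga; split=> //; [exact: ratio_quadratic|exact: ratio_jumps_bounded_below|].
exact: ratio_rjump_union.
Qed.

(** The sums of [log_defect dG] have the same limit as those of the second-order
part of the ratios of [f], that is, the increment of [G - ln f]; so the sums of
[ln (1 + dG) = dG - log_defect dG] tend to the increment of [ln f]. *)
Lemma ratio_product_integral : f a = 1 -> is_product_integral a b lam G f.
Proof.
move=> fa; split=> //.
- split=> //; exists C => // t tab; apply: le_trans (ler_norm _); exact: fC.
- move=> s t as_ st tb.
  have gl t' (tab : a < t' <= b) : 0 < 1 + (G t' - llim G t').
    exact: (ljump_gt rf C0 fC ratio_ljump tab).
  have gr t' (tab : a <= t' < b) : 0 < 1 + (rlim G t' - G t').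
    exact: (rjump_gt rf C0 fC ratio_rjump tab).
  have E := prod_eventually_expR hlam rG ratio_rjump_union gl gr as_ st tb.
  apply: (@cvg_trans _ (expR (G t - G s -
      lam_sum (fun u v => log_defect (G v - G u)) (lam m) s t) @[m --> \oo])).
    by apply: near_eq_cvg; apply: filterS E => m ->.
  rewrite -(expR_increment_ln C0 fC as_ st tb).
  apply: continuous_cvg; first exact: continuous_expR.
  have D := log_defect_vs_ratio hlam rf C0 fC uf qV rG ratio_minus_ln_le
    ratio_rjump_union ratio_ljump ratio_rjump as_ st tb.
  have H m : G t - G s - lam_sum (fun u v => log_defect (G v - G u)) (lam m) s t =
      G t - G s - (lam_sum (fun u v => log_defect (G v - G u) -
        (f v / f u - 1 - (l v - l u))) (lam m) s t +
      lam_sum (fun u v => f v / f u - 1 - (l v - l u)) (lam m) s t).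
    congr (_ - _); rewrite -lam_sumD; congr (lam_sum _ _ _ _).
    by apply/funext => u; apply/funext => v; rewrite subrK.
  rewrite (eq_cvg _ _ H).
  apply: (cvg_lim_eq _ (cvgB (cvg_cst (G t - G s))
    (cvgD D (ratio_defect_cvg as_ st tb)))); rewrite /l; lra.
- by move=> t tab; rewrite ljumpE ?ratio_ljump //; case/andP: tab.
- by move=> t tab; rewrite rjumpE ?ratio_rjump //; case/andP: tab.
Qed.

(** If the product integral of [g] is [f], the sums of [log_defect dg] tend to the
increment of [g - ln f]. They are eventually nonnegative, which makes
[g - ln f] nondecreasing, as the comparison with the ratios of [f] requires. *)
Lemma product_integral_increment g H : Eclass a b lam g ->
  is_product_integral a b lam g H -> (forall t, a <= t <= b -> H t = f t) ->
  forall s t, a <= s -> s < t -> t <= b -> g t - g s = G t - G s.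
Proof.
move=> [[rg _] _ _ ug] [_ _ pH lH eH] Hf.
have gl t : a < t <= b -> 1 + (g t - llim g t) = f t / llim f t.
  move=> /[dup] tab /andP[at_ tb]; rewrite -(ljumpE _ at_) -lH // Hf ?(ltW at_) //.
  congr (_ / _); apply: llim_unique; apply: cvg_trans (llimP rf tab).
  apply: near_eq_cvg; apply: filterS (near_left_itv tab) => x /andP[ax xt].
  by rewrite Hf // ax (le_trans (ltW xt)).
have gr t : a <= t < b -> 1 + (rlim g t - g t) = rlim f t / f t.
  move=> /[dup] tab /andP[at_ tb]; rewrite -(rjumpE _ tb) -eH // Hf ?at_ ?ltW //.
  congr (_ / _); apply: rlim_unique; apply: cvg_trans (rlimP rf tab).
  apply: near_eq_cvg; apply: filterS (near_right_itv tab) => x /andP[tx xb].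
  by rewrite Hf // xb (le_trans at_ (ltW tx)).
have gl0 t (tab : a < t <= b) : 0 < 1 + (g t - llim g t).
  exact: (ljump_gt rf C0 fC gl tab).
have gr0 t (tab : a <= t < b) : 0 < 1 + (rlim g t - g t).
  exact: (rjump_gt rf C0 fC gr tab).
have D s t : a <= s -> s < t -> t <= b ->
    lam_sum (fun u v => log_defect (g v - g u)) (lam m) s t @[m --> \oo] -->
    (g t - l t) - (g s - l s).
  move=> as_ st tb; have sb := le_trans (ltW st) tb; have at_ := le_trans as_ (ltW st).
  have E := prod_eventually_expR hlam rg ug gl0 gr0 as_ st tb.
  have P := pH s t as_ st tb; move: P.
  rewrite !Hf ?as_ ?at_ // -(expR_increment_ln C0 fC as_ st tb) -/(l t) -/(l s).
  move=> P; have {}P : expR (g t - g s -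
      lam_sum (fun u v => log_defect (g v - g u)) (lam m) s t) @[m --> \oo] -->
      expR (l t - l s).
    by apply: cvg_trans P; apply: near_eq_cvg; exact: E.
  have {}P : ln (expR (g t - g s -
      lam_sum (fun u v => log_defect (g v - g u)) (lam m) s t)) @[m --> \oo] -->
      l t - l s.
    rewrite -[l t - l s]expRK; apply: (continuous_cvg _ _ P).
    exact/continuous_ln/expR_gt0.
  have defE m : lam_sum (fun u v => log_defect (g v - g u)) (lam m) s t =
      g t - g s - ln (expR (g t - g s -
        lam_sum (fun u v => log_defect (g v - g u)) (lam m) s t)).
    by rewrite expRK; lra.
  rewrite (eq_cvg _ _ defE).
  by apply: (cvg_lim_eq _ (cvgB (cvg_cst (g t - g s)) P)); lra.
have mono u v : a <= u -> u < v -> v <= b -> g u - l u <= g v - l v.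
  move=> au uv vb; rewrite -subr_ge0.
  exact: (log_defect_sum_ge0 hlam rg ug gl0 gr0 au uv vb (D u v au uv vb)).
move=> s t as_ st tb.
have K := log_defect_vs_ratio hlam rf C0 fC uf qV rg mono ug gl gr as_ st tb.
have K' : lam_sum (fun u v => log_defect (g v - g u)) (lam m) s t @[m --> \oo]
    --> 0 + (G t - l t - (G s - l s)).
  have E m : lam_sum (fun u v => log_defect (g v - g u)) (lam m) s t =
      lam_sum (fun u v => log_defect (g v - g u) -
        (f v / f u - 1 - (l v - l u))) (lam m) s t +
      lam_sum (fun u v => f v / f u - 1 - (l v - l u)) (lam m) s t.
    rewrite -lam_sumD; congr (lam_sum _ _ _ _).
    by apply/funext => u; apply/funext => v; rewrite subrK.
  by rewrite (eq_cvg _ _ E); exact: (cvgD K (ratio_defect_cvg as_ st tb)).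
have : g t - l t - (g s - l s) = 0 + (G t - l t - (G s - l s)).
  exact: (cvg_unique _ (D s t as_ st tb) K').
lra.
Qed.

End RatioIntegral.

Unset Implicit Arguments.

Theorem theorem5 (R : realType) (a b : R) (hab : a < b)
    (lam : nat -> seq R) (hlam : nested_partitions a b lam)
    (U : R -> R -> R) (hU : regulated_evolution a b U)
    (hL : Lclass a b lam (U ^~ a)) :
  [/\ (* (a) *)
      [/\ Lop_defined a b lam (U ^~ a),
          Eclass a b lam (Lop a b lam (U ^~ a)) &
          is_generator a b lam U (Lop a b lam (U ^~ a))],
      (* (b) *)
      product_integrable a b lam (Lop a b lam (U ^~ a)) &
      (* (c) *)
      [/\ Eclass a b lam (Lop a b lam (U ^~ a)),
          product_integrable a b lam (Lop a b lam (U ^~ a)),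
          (forall s t, a <= s -> s <= t -> t <= b ->
             U t s = product_integral a b lam (Lop a b lam (U ^~ a)) s t) &
          forall g : R -> R,
            Eclass a b lam g ->
            product_integrable a b lam g ->
            (forall s t, a <= s -> s <= t -> t <= b ->
               U t s = product_integral a b lam g s t) ->
            exists c : R, forall t, a <= t <= b ->
              g t = Lop a b lam (U ^~ a) t + c]].
Proof.
case: hL => -[rf [V /(quadratic_variation_burkill _ _ rf)[qV _]]] fa [C C0 fC] uf.
have [[hUm hU1] _ _] := hU.
set f := U ^~ a in rf qV fa fC uf *.
have [G0 bG0] := ratio_burkill hlam rf C0 fC uf qV.
have exG : exists G, is_LC_integral a b lam (fun x => (f x)^-1) f G.
  exists (fun x => G0 x - G0 a); apply/(LC_integral_burkill hlam rf C0 fC).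
  by split; [exact: burkill_shift|rewrite subrr].
set G := get [set G | is_LC_integral a b lam (fun x => (f x)^-1) f G].
have isG : is_LC_integral a b lam (fun x => (f x)^-1) f G by apply: getPex.
have [bG Ga] := (LC_integral_burkill hlam rf C0 fC G).1 isG.
have LopG : Lop a b lam f = G.
  by apply/funext => t; rewrite /Lop /LC_integral -/G Ga subr0.
rewrite LopG.
have EG : Eclass a b lam G := ratio_Eclass hab hlam rf C0 fC uf qV bG Ga.
have PG := ratio_product_integral hlam rf C0 fC uf qV bG fa.
have rG : regulated a b G by case: bG.
have piG : product_integrable a b lam G by split=> //; exists f.
have Uf s t : a <= s -> s <= t -> t <= b -> U t s = f t / f s.
  move=> as_ st tb; rewrite /f -(hUm a s t) // mulfK // gt_eqF //.
  by apply: (pos_fun C0 fC); rewrite as_ (le_trans st).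
split; [split=> //|by []|split=> //].
- by split=> //; exact: (regulated_inv rf C0 fC).
- split=> //.
  + move=> s t as_ st tb; case: bG => _ /(_ s t as_ st tb) + _ _.
    apply: cvg_trans; apply: near_eq_cvg; near=> m.
    rewrite (lam_sumE (fun u v => U v u - 1)).
    apply: lam_sum_eq => // [|u v su uv vt]; first exact: (lam_sorted hlam).
    by rewrite Uf //; [exact: (le_trans as_ su)|exact: ltW|exact: (le_trans vt)].
  + move=> t /[dup] tab /andP[at_ _]; rewrite ljumpE //.
    by rewrite -(ratio_ljump rf C0 fC bG tab) -/f; lra.
  + move=> t /[dup] tab /andP[_ tb]; rewrite rjumpE //.
    by rewrite -(ratio_rjump rf bG tab); lra.
- move=> s t as_ st tb; rewrite /product_integral.
  set H := get _; have PH : is_product_integral a b lam G H.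
    by apply: getPex; exists f.
  move: st; rewrite le_eqVlt => /orP[/eqP st|st].
    rewrite st hU1 ?divff //; last by rewrite tb -st as_.
    case: PH => -[_ [c c0 Hc]] _ _ _ _; rewrite -normr_gt0.
    by apply: lt_le_trans (Hc t _); rewrite // tb -st as_.
  rewrite Uf // ?ltW //; case: PG => _ _ /(_ s t as_ st tb) P1 _ _.
  by case: PH => _ _ /(_ s t as_ st tb) P2 _ _; exact: cvg_unique P1 P2.
- move=> g Eg [_ piHg] Ug; exists 0 => t /andP[at_ tb]; rewrite addr0.
  set H := get [set H | is_product_integral a b lam g H] in Ug.
  have PH : is_product_integral a b lam g H by apply: getPex.
  have Hf x : a <= x <= b -> H x = f x.
    move=> /andP[ax xb]; have := Ug a x (lexx _) ax xb.
    rewrite /product_integral -/H /f => ->.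
    by case: PH => _ -> _ _ _; rewrite divr1.
  move: at_; rewrite le_eqVlt => /orP[/eqP <-|at_].
    by rewrite Ga; case: Eg.
  have := product_integral_increment hlam rf C0 fC uf qV bG Eg PH Hf
    (lexx a) at_ tb.
  by rewrite Ga; case: Eg => _ -> _ _; rewrite !subr0.
Unshelve. all: by end_near. Qed.
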